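(* Let $K$ be a field of characteristic $0$ and let $f_0,f_1,f_2,\ldots\in K$. For all integers $i\ge1$ and $j\ge1$, $$\sum_{\substack{C\in\mathcal{RCCD}\\|C|=i+1\\ b(C)=j+1}}f_C=\sum_{k=1}^{i}\sum_{\ell=1}^{j}\binom{j}{\ell}\left(\sum_{\substack{C\in\mathcal{RCCD}\\|C|=k\\ b(C)\ge\ell}}f_C\,f_{b(C)-\ell}\right)\left(\sum_{\substack{C\in\mathcal{RCCD}\\|C|=i-k+1\\ b(C)=j-\ell+1}}f_C\right).$$
   Context: A rooted chord diagram of degree (size) $n\ge1$ consists of $2n$ points $p_1,\dots,p_{2n}$ numbered counterclockwise on a circle, with $p_1$ the root, together with a partition of these points into $n$ pairs called chords; equivalently it is a perfect matching of $\{1,\dots,2n\}$. Two chords $\{p_a,p_c\}$ and $\{p_{a'},p_{c'}\}$ with $a<c$, $a'<c'$, $a<a'$ cross if $a<a'<c<c'$. The diagram is connected if the graph whose vertices are the chords and whose edges are the crossing pairs is connected. $\mathcal{RCCD}$ is the set of rooted connected chord diagrams, and $|C|$ is the number of chords of $C$. The counterclockwise order on chords is the order by smaller endpoint index. A chord is terminal if it crosses no chord that is larger in the counterclockwise order. The intersection order on the chords of a connected diagram is defined recursively: the counterclockwise-smallest chord comes first; after deleting it, the remaining chords split into connected components (of the crossing graph), which are listed by increasing counterclockwise-smallest chord; then come the chords of the first component in the intersection order of that component, then those of the second component, and so on. Label the chords $1,\dots,n$ in the intersection order. Let $t_1<t_2<\dots<t_{k+1}$ be the labels of the terminal chords. Then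 $b(C)=t_1$, and with the gaps $\delta_i=t_{i+1}-t_i$ ($1\le i\le k$), $$f_C=f_0^{\,n-k-1}f_{\delta_1}f_{\delta_2}\cdots f_{\delta_k}.$$ *)

(* Defs.v *)
From mathcomp Require Import all_boot all_algebra.

Set Implicit Arguments.
Unset Strict Implicit.
Unset Printing Implicit Defensive.

(* Points are the ordinals below m, the root being 0.  A chord {p_a, p_c} with
   a < c is represented by the ordered pair (a, c). *)
Notation chord m := ('I_m * 'I_m)%type.

Definition diagram (n : nat) (C : {set chord n.*2}) : bool :=
  [forall c in C, c.1 < c.2] &&
  [forall p : 'I_(n.*2), #|[set c in C | (p == c.1) || (p == c.2)]| == 1].

Definition crossing (m : nat) (c d : chord m) : bool :=
  [&& c.1 < d.1, d.1 < c.2 & c.2 < d.2] || [&& d.1 < c.1, c.1 < d.2 & d.2 < c.2].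

Definition crossing_graph (m : nat) (S : {set chord m}) : rel (chord m) :=
  fun c d => [&& c \in S, d \in S & crossing c d].

Definition connected (m : nat) (S : {set chord m}) : bool :=
  [forall c in S, forall d in S, connect (crossing_graph S) c d].

Definition rccd (n : nat) : {set {set chord n.*2}} :=
  [set C | [&& 0 < n, diagram C & connected C]].

Definition ccw_le (m : nat) : rel (chord m) := fun c d => c.1 <= d.1.

Definition ccw_enum (m : nat) (S : {set chord m}) : seq (chord m) :=
  sort (@ccw_le m) (enum S).

Definition terminal (m : nat) (C : {set chord m}) (c : chord m) : bool :=
  [forall d in C, (c.1 < d.1) ==> ~~ crossing c d].

Definition component (m : nat) (S : {set chord m}) (c : chord m) :
    {set chord m} :=
  [set d in S | connect (crossing_graph S) c d].

(* Each component is listed once, at the position of its smallest chord. *)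
Definition components (m : nat) (S : {set chord m}) : seq {set chord m} :=
  [seq component S c | c <- ccw_enum S & [forall d in component S c, ccw_le c d]].

(* Recursive calls are on proper subsets of S, so any depth >= #|S| gives the
   same result. *)
Fixpoint intersection_order_rec (m depth : nat) (S : {set chord m}) :
    seq (chord m) :=
  if depth is depth'.+1 then
    if ccw_enum S is c :: _ then
      c :: flatten [seq intersection_order_rec depth' T | T <- components (S :\ c)]
    else [::]
  else [::].

Definition intersection_order (m : nat) (C : {set chord m}) : seq (chord m) :=
  intersection_order_rec #|C| C.

Definition label (m : nat) (C : {set chord m}) (c : chord m) : nat :=
  (index c (intersection_order C)).+1.

(* [:: t_1; ...; t_(k+1)] *)
Definition terminal_labels (m : nat) (C : {set chord m}) : seq nat :=
  sort leq [seq label C c | c <- enum C & terminal C c].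

(* The statistic b(C). *)
Definition first_terminal (m : nat) (C : {set chord m}) : nat :=
  head 0 (terminal_labels C).

(* The monomial f_C: with t = [:: t_1; ...; t_(k+1)], the exponent n - k - 1 is
   #|C| - size t. *)
Definition weight (K : fieldType) (f : nat -> K) (m : nat) (C : {set chord m}) :
    K :=
  let t := terminal_labels C in
  (f 0%N ^+ (#|C| - size t) *
   \prod_(i < (size t).-1) f (nth 0%N t i.+1 - nth 0%N t i)%N)%R.

(* Main.v *)
(** Deleting the root chord of a connected diagram C with at least two chords
    leaves connected components; let D be the first of them and C1 the rest of C,
    root included.  The intersection order of C lists the root, then D, then the
    remaining chords of C1, and the last chord of D is terminal, so
      b(C) = b(D) + 1   and   f_C = f_C1 f_(b(C1) - 1) f_D.
    Components do not interleave and are all crossed by the root chord, so C1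
    minus its root lies in one of the 2 |D| - 1 inner gaps of D; hence C
    corresponds to (C1, D, gap).  Writing B_j and A_l for the generating series,
    in the number of chords, of the f_C with b(C) = j and of the
    f_C f_(b(C) - l) with b(C) >= l, and L = A_1 (2 X d/dX - 1), the bijection gives
      B_(j+1) = L B_j (j >= 1),  A_(l+1) = L A_l (l >= 1),  B_1 = X,  A_1 = - L 1.
    So W_j = sum_l binomial(j, l) (L^l 1) (L^(j-l) X) satisfies
    W_(j+1) = A_1 (2 X d/dX - 2) W_j with W_0 = X, whence W_j = 0 for j >= 1,
    which is the claim coefficientwise. *)

Require Import Defs.
From mathcomp Require Import all_boot all_algebra.
From mathcomp Require Import zify ring.

Set Implicit Arguments.
Unset Strict Implicit.
Unset Printing Implicit Defensive.

Import GRing.Theory.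

(** * Connected components and the intersection order *)

Section Connectivity.
Variable m : nat.
Implicit Types (c d x y : chord m) (S T : {set chord m}).

Lemma crossing_sym : symmetric (@crossing m).
Proof. by move=> c d; rewrite /crossing orbC. Qed.

Lemma crossing_graph_sym S : symmetric (crossing_graph S).
Proof. by move=> c d; rewrite /crossing_graph crossing_sym andbCA. Qed.

Lemma crossing_connect_sym S : connect_sym (crossing_graph S).
Proof. exact/sym_connect_sym/crossing_graph_sym. Qed.

Lemma crossing_closed S (a : {pred chord m}) :
  (forall x y, x \in S -> y \in S -> crossing x y -> x \in a -> y \in a) ->
  closed (crossing_graph S) a.
Proof.
move=> H; apply: intro_closed; first exact: crossing_connect_sym.
by move=> x y /and3P[xS yS xy]; apply: H.
Qed.

Lemma connect_mono S T c d :
  T \subset S -> connect (crossing_graph T) c d -> connect (crossing_graph S) c d.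
Proof.
move=> /subsetP sTS; apply: connect_sub => x y /and3P[xT yT xy].
by apply: connect1; rewrite /crossing_graph !sTS.
Qed.

Lemma connectedP S :
  reflect {in S &, forall c d, connect (crossing_graph S) c d} (connected S).
Proof.
apply: (iffP forall_inP) => [H c d cS dS|H c cS].
  by move/forall_inP: (H c cS) => ->.
by apply/forall_inP => d dS; apply: H.
Qed.

Lemma connected_sub_closed S (a : {pred chord m}) x :
  connected S -> x \in S -> x \in a ->
  (forall y z, y \in S -> z \in S -> crossing y z -> y \in a -> z \in a) ->
  {in S, forall y, y \in a}.
Proof.
move=> /connectedP cS xS xa H y yS.
by rewrite -(closed_connect (crossing_closed H) (cS x y xS yS)).
Qed.

Lemma mem_component S c : c \in S -> c \in component S c.
Proof. by move=> cS; rewrite inE cS /= connect0. Qed.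

Lemma component_sub S c : component S c \subset S.
Proof. by apply/subsetP => x; rewrite inE => /andP[]. Qed.

Lemma component_crossing S c x y :
  x \in component S c -> y \in S :\: component S c -> ~~ crossing x y.
Proof.
rewrite !inE => /andP[xS cx] /andP[+ yS]; rewrite yS /=.
apply: contra => xy; apply: connect_trans cx (connect1 _).
by rewrite /crossing_graph xS yS.
Qed.

Lemma component_connected S c : c \in S -> connected (component S c).
Proof.
move=> cS; set T := component S c; have cT : c \in T by apply: mem_component.
have H x : x \in T -> connect (crossing_graph T) c x.
  rewrite inE => /andP[xS cx].
  suff cl : closed (crossing_graph S) (connect (crossing_graph T) c).
    by rewrite -[_ x]/(x \in connect _ c) -(closed_connect cl cx) inE connect0.
  apply: crossing_closed => y z yS zS yz; rewrite !inE => cy.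
  have cy' : connect (crossing_graph S) c y.
    exact: connect_mono (component_sub S c) cy.
  apply: connect_trans cy (connect1 _).
  rewrite /crossing_graph !inE yS zS yz cy' /= andbT.
  by apply: connect_trans cy' (connect1 _); rewrite /crossing_graph yS zS.
apply/connectedP => x y xT yT.
by apply: connect_trans (H y yT); rewrite crossing_connect_sym H.
Qed.

(** Paths cannot leave [T] because no crossing does, and connectedness of [T] reaches all of it. The
    criterion identifies components without exhibiting paths. *)
Lemma component_eq S T c :
  c \in T -> T \subset S -> connected T ->
  {in T & S :\: T, forall x y, ~~ crossing x y} -> component S c = T.
Proof.
move=> cT sTS /connectedP coT noX; apply/setP => x; rewrite inE; apply/idP/idP.
  case/andP=> xS /(closed_connect (a := [in T])) <- //.
  apply: crossing_closed => y z yS zS yz yT; apply: contraLR yz => zT.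
  by apply: noX => //; rewrite inE zS andbT.
by move=> xT; rewrite (subsetP sTS) //= (connect_mono sTS) ?coT.
Qed.

Lemma component_closed_sub S T c :
  T \subset S -> {in T & S :\: T, forall x y, ~~ crossing x y} -> c \in T ->
  component S c = component T c.
Proof.
move=> sTS noX cT; apply: component_eq.
- exact: mem_component.
- exact: subset_trans (component_sub _ _) sTS.
- exact: component_connected.
move=> x y xC; rewrite inE => /andP[yC yS].
have xT := subsetP (component_sub _ _) _ xC.
have [yT|yT] := boolP (y \in T).
  by apply: component_crossing xC _; rewrite inE yC.
by apply: noX => //; rewrite inE yT.
Qed.

Lemma component_compl S c e :
  e \in S :\: component S c -> component (S :\: component S c) e = component S e.
Proof.
move=> eS; apply/esym/component_closed_sub => //; rewrite ?subsetDl //.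
move=> x y xS; rewrite !in_setD negb_and negbK => /andP[/orP[yC yS|/negPf->//]].
by rewrite crossing_sym; apply: component_crossing yC xS.
Qed.

Lemma connectedU S T x y :
  connected S -> connected T -> x \in S -> y \in T -> crossing x y ->
  connected (S :|: T).
Proof.
move=> /connectedP cS /connectedP cT xS yT xy; set U := S :|: T.
have toX z : z \in U -> connect (crossing_graph U) x z.
  case/setUP=> [zS|zT]; first by apply: connect_mono (cS _ _ xS zS); apply: subsetUl.
  apply: (@connect_trans _ _ y); last by apply: connect_mono (cT _ _ yT zT); apply: subsetUr.
  by apply: connect1; rewrite /crossing_graph !inE xS yT xy orbT.
apply/connectedP => z w zU wU.
by apply: connect_trans (toX w wU); rewrite crossing_connect_sym toX.
Qed.

End Connectivity.

(** * The counterclockwise order and the recursion for the intersection order *)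

Section Order.
Variable m : nat.
Implicit Types (c d x y : chord m) (S T D : {set chord m}).

Lemma ccw_le_total : total (@ccw_le m).
Proof. by move=> c d; apply: leq_total. Qed.

Lemma ccw_le_trans : transitive (@ccw_le m).
Proof. by move=> c d e; apply: leq_trans. Qed.

(** Makes the counterclockwise order antisymmetric on [S], so that sorting is canonical. Every
    matching satisfies it, and it passes to the subsets met in the recursion. *)
Definition ccw_inj S := {in S &, injective (fun c : chord m => c.1)}.

Definition ccw_min S c := (c \in S) && [forall d in S, ccw_le c d].

Lemma ccw_minP S c : reflect (c \in S /\ {in S, forall d, ccw_le c d}) (ccw_min S c).
Proof. by apply: (iffP andP) => -[cS /forall_inP H]; split=> //; apply/forall_inP. Qed.

Lemma ccw_inj_sub S T : T \subset S -> ccw_inj S -> ccw_inj T.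
Proof. by move=> /subsetP sTS iS x y /sTS xS /sTS yS; apply: iS. Qed.

Lemma ccw_min_sub S T c : T \subset S -> c \in T -> ccw_min S c -> ccw_min T c.
Proof.
move=> /subsetP sTS cT /ccw_minP[_ H]; apply/ccw_minP; split=> // d /sTS; exact: H.
Qed.

Lemma ccw_min_exists S : S != set0 -> exists c, ccw_min S c.
Proof.
case/set0Pn=> c0 c0S.
have [c cS H] := arg_minnP (fun c : chord m => nat_of_ord c.1) c0S.
by exists c; apply/ccw_minP.
Qed.

Lemma ccw_min_uniq S c d : ccw_inj S -> ccw_min S c -> ccw_min S d -> c = d.
Proof.
move=> iS /ccw_minP[cS Hc] /ccw_minP[dS Hd]; apply: iS => //.
by apply/val_inj/eqP; rewrite eqn_leq [_ <= _](Hc d dS) [_ <= _](Hd c cS).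
Qed.

Lemma mem_ccw_enum S : ccw_enum S =i S.
Proof. by move=> x; rewrite mem_sort mem_enum. Qed.

Lemma ccw_enum_filter S T :
  T \subset S -> ccw_enum T = [seq x <- ccw_enum S | x \in T].
Proof.
move=> /setIidPr sTS; rewrite filter_sort; last 2 first.
- exact: ccw_le_total.
- exact: ccw_le_trans.
congr sort; rewrite -{1}sTS /enum_mem -filter_predI.
by apply: eq_filter => x; rewrite /= !inE andbC.
Qed.

Lemma ccw_enum_min S c :
  ccw_inj S -> ccw_min S c -> ccw_enum S = c :: ccw_enum (S :\ c).
Proof.
move=> iS /ccw_minP[cS Hc]; apply: (@sorted_eq_in _ (@ccw_le m)).
- by move=> ? ? ? _ _ _; apply: ccw_le_trans.
- move=> x y; rewrite !mem_ccw_enum => xS yS /andP[xy yx].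
  by apply: iS => //; apply/val_inj/eqP; rewrite eqn_leq [_ <= _]xy [_ <= _]yx.
- exact/sort_sorted/ccw_le_total.
- rewrite /= path_sortedE; last exact: ccw_le_trans.
  rewrite (sort_sorted ccw_le_total) andbT; apply/allP => x.
  by rewrite mem_ccw_enum inE => /andP[_]; apply: Hc.
apply: uniq_perm.
- by rewrite sort_uniq enum_uniq.
- by rewrite /= mem_ccw_enum !inE eqxx sort_uniq enum_uniq.
by move=> x; rewrite in_cons !mem_ccw_enum !inE; case: eqVneq => // ->.
Qed.

(** A component is listed at its least chord, so the list starts with the one through [c]; removing
    that component leaves the others and their least chords unchanged. *)
Lemma components_min S c :
  ccw_inj S -> ccw_min S c ->
  components S = component S c :: components (S :\: component S c).
Proof.
move=> iS mc; have /ccw_minP[cS Hc] := mc; set D := component S c.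
have cD : c \in D by apply: mem_component.
have sDS : S :\: D \subset S by apply: subsetDl.
rewrite /components (ccw_enum_filter sDS) (ccw_enum_min iS mc) /= in_setD cD /=.
rewrite ifT; last first.
  by apply/forall_inP => d /(subsetP (component_sub _ _)); apply: Hc.
congr (_ :: _); rewrite -filter_predI.
have -> : [seq x <- ccw_enum (S :\ c) | [forall d in component S x, ccw_le x d]] =
  [seq x <- ccw_enum (S :\ c) |
     (predI (fun c0 => [forall d in component (S :\: D) c0, ccw_le c0 d])
            (mem (S :\: D))) x].
  apply: eq_in_filter => x; rewrite mem_ccw_enum in_setD1 => /andP[xc xS] /=.
  have [xD|xD] := boolP (x \in D); last first.
    by rewrite component_compl in_setD xD xS ?andbT.
  (* A chord of [D] other than [c] is not least in its component, which contains [c]. *)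
  rewrite in_setD xD /= andbF; apply/negP => /forall_inP H.
  have cx : c \in component S x.
    by move: xD; rewrite !inE crossing_connect_sym cS => /andP[].
  case/negP: xc; apply/eqP/iS => //; apply/val_inj/eqP.
  by rewrite eqn_leq [_ <= _](H c cx) [_ <= _](Hc x xS).
apply/eq_in_map => x; rewrite mem_filter /= => /andP[/andP[_ xD] _].
by rewrite component_compl.
Qed.

(** The listing of a possibly disconnected set, as it arises once the root chord is deleted. *)
Definition forest_order S := flatten [seq intersection_order T | T <- components S].

Lemma mem_components S T : T \in components S -> T \subset S.
Proof. by case/mapP => x _ ->; apply: component_sub. Qed.

Lemma intersection_order_depth k S :
  #|S| <= k -> intersection_order_rec k S = intersection_order S.
Proof.
(* Strong induction, so that the hypothesis applies in the recursive calls both to the remaining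
   depth and to the depth prescribed by [#|S|]. *)
elim: k {-2}k (leqnn k) S => [|K IH] k kK S Sk; rewrite /intersection_order.
  have -> : k = 0 by lia.
  by have -> : #|S| = 0 by lia.
have [S0|S0] := eqVneq S set0.
  rewrite S0 cards0 /=; case: k {kK Sk} => //= k.
  by rewrite /ccw_enum enum_set0.
case EkS: #|S| Sk => [|s] Sk; first by move/eqP: EkS; rewrite cards_eq0 (negPf S0).
case: k kK Sk => // k kK Sk /=.
case E: (ccw_enum S) => [|c t] //; congr (_ :: flatten _).
apply/eq_in_map => T /mem_components /subset_leq_card TS.
have cS : c \in S by rewrite -mem_ccw_enum E mem_head.
have Ts : #|T| <= s by rewrite -ltnS -EkS (cardsD1 c S) cS.
by rewrite !IH //; lia.
Qed.

Lemma intersection_order0 : intersection_order (set0 : {set chord m}) = [::].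
Proof. by rewrite /intersection_order cards0. Qed.

Lemma forest_order0 : forest_order set0 = [::].
Proof. by rewrite /forest_order /components /ccw_enum enum_set0. Qed.

Lemma intersection_order_min S c :
  ccw_inj S -> ccw_min S c -> intersection_order S = c :: forest_order (S :\ c).
Proof.
move=> iS mc; have /ccw_minP[cS _] := mc.
rewrite /intersection_order (cardsD1 c) cS /= (ccw_enum_min iS mc).
congr (_ :: flatten _); apply/eq_in_map => T /mem_components /subset_leq_card TS.
exact: intersection_order_depth.
Qed.

Lemma forest_order_min S c :
  ccw_inj S -> ccw_min S c ->
  forest_order S =
    intersection_order (component S c) ++ forest_order (S :\: component S c).
Proof. by move=> iS mc; rewrite /forest_order (components_min iS mc). Qed.

(* Induction along the recursion defining the intersection order: [c] is
   deleted from its component, and that component from [S]. *)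
Lemma forest_ind (P : {set chord m} -> Prop) :
  P set0 ->
  (forall S c, ccw_inj S -> ccw_min S c ->
     P (component S c :\ c) -> P (S :\: component S c) -> P S) ->
  forall S, ccw_inj S -> P S.
Proof.
move=> P0 IH S; move: {2}#|S| (leqnn #|S|) => k; elim: k S => [|k IHk] S Sk iS.
  by have -> : S = set0 by apply/eqP; rewrite -cards_eq0 -leqn0.
have [->//|S0] := eqVneq S set0.
have [c mc] := ccw_min_exists S0; have /ccw_minP[cS _] := mc.
have cC := mem_component cS; have CS := component_sub S c.
apply: (IH S c) => //; apply: IHk.
- rewrite -ltnS; apply: leq_trans Sk; apply: leq_trans (subset_leq_card CS).
  by rewrite (cardsD1 c (component _ _)) cC.
- by apply: ccw_inj_sub iS; apply: subset_trans CS; apply: subsetDl.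
- have : 0 < #|component S c| by apply/card_gt0P; exists c.
  by have := cardsID (component S c) S; rewrite (setIidPr CS); lia.
- by apply: ccw_inj_sub iS; apply: subsetDl.
Qed.

Lemma forest_order_unfold S c :
  ccw_inj S -> ccw_min S c ->
  forest_order S = (c :: forest_order (component S c :\ c)) ++
                   forest_order (S :\: component S c).
Proof.
move=> iS mc; rewrite (forest_order_min iS mc); congr (_ ++ _).
have /ccw_minP[cS _] := mc; apply: intersection_order_min.
  exact: ccw_inj_sub (component_sub _ _) iS.
exact: ccw_min_sub (component_sub _ _) (mem_component cS) mc.
Qed.

Lemma forest_order_enum S :
  ccw_inj S -> uniq (forest_order S) /\ forest_order S =i S.
Proof.
move: S; apply: forest_ind; first by rewrite forest_order0; split=> // x; rewrite inE.
move=> S c iS mc [u1 m1] [u2 m2]; have /ccw_minP[cS _] := mc.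
have cC := mem_component cS; rewrite (forest_order_unfold iS mc); split.
  rewrite /= cat_uniq u1 u2 mem_cat m1 m2 !inE eqxx cS connect0 /= andbT.
  apply/hasPn => x; rewrite m2 m1 !inE => /andP[H xS].
  by rewrite negb_and H orbT.
move=> x; rewrite mem_cat inE m1 m2 !inE.
by have [->|_] := eqVneq x c; rewrite ?cS //=; case: (x \in S); case: connect.
Qed.

Lemma intersection_order_perm S :
  ccw_inj S -> perm_eq (intersection_order S) (enum S).
Proof.
move=> iS; have [->|S0] := eqVneq S set0; first by rewrite intersection_order0 enum_set0.
have [c mc] := ccw_min_exists S0; have /ccw_minP[cS _] := mc.
rewrite (intersection_order_min iS mc).
have [u e] := forest_order_enum (ccw_inj_sub (subsetDl S [set c]) iS).
apply: uniq_perm; rewrite ?enum_uniq //=; first by rewrite u e !inE eqxx.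
by move=> x; rewrite mem_enum in_cons e !inE; case: eqVneq => // ->.
Qed.

(** Terminality depends only on crossings with later chords; this lets it be computed inside a
    component, outside one, or without the root chord. *)
Lemma terminal_sub S T c :
  T \subset S -> {in S :\: T, forall d, c.1 < d.1 -> ~~ crossing c d} ->
  terminal S c = terminal T c.
Proof.
move=> /subsetP sTS H; apply/forall_inP/forall_inP => H' d.
  by move/sTS; apply: H'.
move=> dS; have [/H'//|dT] := boolP (d \in T).
by apply/implyP; apply: H; rewrite inE dT.
Qed.

Lemma terminal_component S c d :
  d \in component S c -> terminal S d = terminal (component S c) d.
Proof.
move=> dC; apply: terminal_sub; first exact: component_sub.
by move=> e eS _; apply: component_crossing dC eS.
Qed.

Lemma terminal_compl S c d :
  d \in S :\: component S c -> terminal S d = terminal (S :\: component S c) d.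
Proof.
move=> dC; apply: terminal_sub; first exact: subsetDl.
move=> e; rewrite !in_setD negb_and negbK => /andP[/orP[eC eS _|/negPf->//]].
by rewrite crossing_sym; apply: component_crossing eC dC.
Qed.

Lemma terminal_min S c d : d \in S :\ c -> ccw_min S c -> terminal S d = terminal (S :\ c) d.
Proof.
move=> dS /ccw_minP[cS Hc]; apply: terminal_sub; first exact: subsetDl.
move=> e; rewrite in_setD in_setD1 negb_and negbK => /andP[/orP[/eqP-> eS|/negPf->//]].
have dS' : d \in S by move: dS; rewrite inE => /andP[].
by move=> dc; move: (Hc d dS'); rewrite /ccw_le leqNgt dc.
Qed.

Lemma forest_order_last_mem S x0 :
  ccw_inj S -> S != set0 -> last x0 (forest_order S) \in S.
Proof.
move=> iS S0; have [_ eS] := forest_order_enum iS; rewrite -eS.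
case E: (forest_order S) => [|a l]; last exact: (mem_last a l).
by have [z zS] := set0Pn _ S0; move: (eS z); rewrite E zS.
Qed.

(* Terminality of the last chord of each component is what makes the gap
   between consecutive components equal to the b-statistic of the second. *)
Lemma forest_order_last S x0 :
  ccw_inj S -> S != set0 -> terminal S (last x0 (forest_order S)).
Proof.
move=> iS; move: S iS x0; apply: forest_ind; first by rewrite eqxx.
move=> S c iS mc IH1 IH2 x0 _; have /ccw_minP[cS Hc] := mc.
have cC := mem_component cS; rewrite (forest_order_unfold iS mc) last_cat.
have iS2 := ccw_inj_sub (subsetDl S (component S c)) iS.
have [S2|S2] := eqVneq (S :\: component S c) set0; last first.
  by rewrite (@terminal_compl S c) ?IH2 ?forest_order_last_mem.
rewrite S2 forest_order0 /=.
have iC := ccw_inj_sub (component_sub S c) iS.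
have mC := ccw_min_sub (component_sub S c) cC mc.
have iC1 := ccw_inj_sub (subsetDl (component S c) [set c]) iC.
have [C0|C0] := eqVneq (component S c :\ c) set0.
  rewrite C0 forest_order0 /=; rewrite (@terminal_component S c c) //.
  apply/forall_inP => d dC; have [->|dc] := eqVneq d c; first by rewrite ltnn.
  have : d \in component S c :\ c by rewrite in_setD1 dc dC.
  by rewrite C0 inE.
have := IH1 c C0; set z := last _ _ => tz.
have zC : z \in component S c :\ c by apply: forest_order_last_mem.
rewrite (@terminal_component S c); last by move: zC; rewrite inE => /andP[].
by rewrite (terminal_min zC).
Qed.

End Order.

(** * Weights read off the sequence of terminal chords *)

Section TerminalMask.
Variable m : nat.
Implicit Types (c d x y : chord m) (S T D : {set chord m}).

(** Both [weight] and [first_terminal] depend on a diagram only through this Boolean word. *)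
Definition terminal_mask S : seq bool :=
  [seq terminal S c | c <- intersection_order S].

Lemma size_terminal_mask S : ccw_inj S -> size (terminal_mask S) = #|S|.
Proof. by move=> iS; rewrite size_map (perm_size (intersection_order_perm iS)) cardE. Qed.

Lemma root_crossing S c :
  connected S -> c \in S -> S != [set c] -> exists2 d, d \in S :\ c & crossing c d.
Proof.
move=> coS cS Sc; apply/exists_inP; apply: contraNT Sc => /exists_inPn H.
rewrite eqEsubset sub1set cS andbT; apply/subsetP.
apply: (connected_sub_closed coS cS); rewrite ?inE // => x y xS yS + /set1P xc.
rewrite xc in_set1; apply: contraLR => yc; apply: H.
by rewrite in_setD1 yc.
Qed.

Lemma nonterminal_root S c d : ccw_inj S -> ccw_min S c -> d \in S :\ c ->
  crossing c d -> terminal S c = false.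
Proof.
move=> iS /ccw_minP[cS Hc] /setD1P[dc dS] cd; apply/negP => /forall_inP/(_ d dS).
rewrite cd implybF -leqNgt => dc'; case/eqP: dc; apply: iS => //.
by apply/val_inj/eqP; rewrite eqn_leq dc'; apply: Hc.
Qed.

(** The two shapes for a nonempty connected set: a lone chord, or a root chord made nonterminal by a
    crossing, followed by a list whose last chord is terminal. *)
Definition connected_mask (t : seq bool) :=
  t = [:: true] \/ exists2 t', t = false :: t' & last false t'.

Lemma terminal_mask_connected S :
  ccw_inj S -> connected S -> S != set0 -> connected_mask (terminal_mask S).
Proof.
move=> iS coS S0; have [c mc] := ccw_min_exists S0; have /ccw_minP[cS _] := mc.
rewrite /connected_mask /terminal_mask (intersection_order_min iS mc) /=.
have iSc := ccw_inj_sub (subsetDl S [set c]) iS.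
have [->|Sc] := eqVneq S [set c].
  left; rewrite setDv forest_order0 /=; congr [:: _]; apply/forall_inP => d.
  by rewrite inE => /eqP->; rewrite ltnn.
have [d dS cd] := root_crossing coS cS Sc.
rewrite (nonterminal_root iS mc dS cd); right; eexists; first by [].
have := @forest_order_last _ (S :\ c) c iSc.
have := @forest_order_last_mem _ (S :\ c) c iSc.
have S1 : S :\ c != set0 by apply/set0Pn; exists d.
move=> /(_ S1) + /(_ S1).
case: (forest_order (S :\ c)) => [|a l]; first by rewrite /= !inE eqxx.
rewrite /= (last_map (terminal S)) => lS tl.
by rewrite (terminal_min lS).
Qed.

(** Splitting off the root chord and the first component does not affect terminality of the other
    chords. [behead] drops the entry of the root chord in the complement, where it may be terminal
    although it is not in [S]. *)
Lemma terminal_mask_split S c d e :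
  ccw_inj S -> ccw_min S c -> ccw_min (S :\ c) d ->
  e \in component (S :\ c) d -> crossing c e ->
  terminal_mask S = false :: terminal_mask (component (S :\ c) d) ++
                    behead (terminal_mask (S :\: component (S :\ c) d)).
Proof.
move=> iS mc md eD ce; set D := component _ d; have /ccw_minP[cS _] := mc.
have sDS : D \subset S :\ c by apply: component_sub.
have cD : c \notin D by apply: contraT => /negbNE/(subsetP sDS); rewrite !inE eqxx.
have iSc := ccw_inj_sub (subsetDl S [set c]) iS.
have sSD : S :\: D \subset S by apply: subsetDl.
have mcD : ccw_min (S :\: D) c by apply: ccw_min_sub sSD _ mc; rewrite in_setD cD cS.
have eSD : S :\: D :\ c = S :\ c :\: D by rewrite !setDDl setUC.
rewrite /terminal_mask (intersection_order_min iS mc) (forest_order_min iSc md).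
rewrite (intersection_order_min (ccw_inj_sub sSD iS) mcD) /= map_cat eSD.
rewrite (@nonterminal_root S c e) ?(subsetP sDS) //.
have iD := ccw_inj_sub sDS iSc.
have iE := ccw_inj_sub (subsetDl (S :\ c) D) iSc.
congr (_ :: _ ++ _).
  apply/eq_in_map => x; rewrite (perm_mem (intersection_order_perm iD)) mem_enum => xD.
  by rewrite (terminal_min (subsetP sDS _ xD)) // (terminal_component xD).
apply/eq_in_map => x; rewrite (forest_order_enum iE).2 => xE.
rewrite (terminal_min (subsetP (subsetDl _ _) _ xE)) // (terminal_compl xE) -eSD.
by rewrite -eSD in xE; rewrite (terminal_min xE).
Qed.

End TerminalMask.

Section MaskLabels.

Definition mask_labels (t : seq bool) := mask t (iota 1 (size t)).

Lemma mask_labels_cat t t' :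
  mask_labels (t ++ t') = mask_labels t ++ map (addn (size t)) (mask_labels t').
Proof.
by rewrite /mask_labels size_cat iotaD mask_cat ?size_iota // addnC iotaDl map_mask.
Qed.

Lemma mask_labels_cons b t :
  mask_labels (b :: t) = nseq b 1 ++ map S (mask_labels t).
Proof. by rewrite -cat1s mask_labels_cat; case: b. Qed.

Lemma last_mask_labels t : last false t -> last 0 (mask_labels t) = size t.
Proof.
elim/last_ind: t => // t b _; rewrite last_rcons => ->.
by rewrite -cats1 mask_labels_cat last_cat /= size_cat.
Qed.

Lemma size_mask_labels t : size (mask_labels t) = count id t.
Proof. by rewrite size_mask // size_iota. Qed.

Lemma mask_index (T : eqType) (P : pred T) (s : seq T) : uniq s ->
  [seq (index x s).+1 | x <- s & P x] = mask_labels (map P s).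
Proof.
move=> us; rewrite filter_mask map_mask /mask_labels size_map; congr mask.
case: s us => // x0 s us; apply: (@eq_from_nth _ 0); first by rewrite size_map size_iota.
move=> i; rewrite size_map => ilt.
by rewrite (nth_map x0) // index_uniq // nth_iota.
Qed.

(** Along the intersection order the labels of terminal chords are already increasing, and sorting
    is insensitive to permutation. *)
Lemma terminal_labels_mask m (S : {set chord m}) :
  ccw_inj S -> terminal_labels S = mask_labels (terminal_mask S).
Proof.
move=> iS; have pS := intersection_order_perm iS.
have uS : uniq (intersection_order S) by rewrite (perm_uniq pS) enum_uniq.
rewrite /terminal_mask -mask_index // /terminal_labels.
have srt : sorted leq [seq (index x (intersection_order S)).+1 |
               x <- intersection_order S & terminal S x].
  rewrite mask_index //; apply: (subseq_sorted leq_trans) (mask_subseq _ _) _.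
  exact: iota_sorted.
rewrite -[RHS](sorted_sort leq_trans srt).
apply/(perm_sortP leq_total leq_trans anti_leq)/perm_map.
by rewrite perm_sym perm_filter.
Qed.

Variables (K : fieldType) (f : nat -> K).
Local Open Scope ring_scope.

Definition gap_product (s : seq nat) : K :=
  \prod_(i < (size s).-1) f (nth 0%N s i.+1 - nth 0%N s i)%N.

Lemma gap_product_cons x y s :
  gap_product [:: x, y & s] = f (y - x)%N * gap_product (y :: s).
Proof. by rewrite /gap_product /= big_ord_recl. Qed.

Lemma gap_product_cat x s y s' :
  gap_product ((x :: s) ++ y :: s') =
  gap_product (x :: s) * f (y - last x s)%N * gap_product (y :: s').
Proof.
elim: s x => [|z s IH] x.
  by rewrite /= gap_product_cons {2}/gap_product big_ord0 mul1r.
by rewrite /= !gap_product_cons [X in _ * X]IH !mulrA.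
Qed.

Lemma gap_product_shift k s : gap_product (map (addn k) s) = gap_product s.
Proof.
rewrite /gap_product size_map; apply: eq_bigr => -[i /= ilt] _.
by rewrite !(nth_map 0%N) ?subnDl //; lia.
Qed.

Definition mask_weight (t : seq bool) : K :=
  f 0%N ^+ (size t - count id t) * gap_product (mask_labels t).

Lemma weight_mask m (S : {set chord m}) :
  ccw_inj S -> weight f S = mask_weight (terminal_mask S).
Proof.
move=> iS; rewrite /weight /mask_weight terminal_labels_mask //.
by rewrite -size_mask_labels size_terminal_mask.
Qed.

Lemma mask_weight_false t : mask_weight (false :: t) = f 0%N * mask_weight t.
Proof.
rewrite /mask_weight mask_labels_cons /= add0n subSn ?count_size // exprS -mulrA.
by rewrite -[map S _]/(map (addn 1) _) gap_product_shift.
Qed.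

(** Since [t] ends in [true], its last label is [size t], so the only new gap, at the junction,
    equals the first label of [t']. *)
Lemma mask_weight_cat t t' : last false t -> last false t' ->
  mask_weight (t ++ t') =
  mask_weight t * f (head 0%N (mask_labels t')) * mask_weight t'.
Proof.
move=> lt lt'; rewrite /mask_weight size_cat count_cat mask_labels_cat.
have -> : (size t + size t' - (count id t + count id t') =
           (size t - count id t) + (size t' - count id t'))%N.
  by have := count_size id t; have := count_size id t'; lia.
rewrite exprD; have := last_mask_labels lt; have := last_mask_labels lt'.
have := gap_product_shift (size t) (mask_labels t').
case: (mask_labels t) => [|x s].
  by case: (t) lt => [|b u].
case: (mask_labels t') => [|y s'].
  by case: (t') lt' => [|b u].
move=> gp _ /= lx; rewrite [map _ _]/= in gp.
by rewrite -cat_cons gap_product_cat gp lx addKn; ring.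
Qed.

(** The leading [false] contributes [f 0]. If [t'] is a lone [true], this is the factor at index 0;
    otherwise it stands for the [false] at the head of [t'], and the junction gap is the first label
    of [t'] minus one. *)
Lemma mask_weight_split t t' : connected_mask t -> connected_mask t' ->
  mask_weight (false :: t ++ behead t') =
  mask_weight t' * f (head 0%N (mask_labels t')).-1 * mask_weight t.
Proof.
move=> Ct Ct'; rewrite mask_weight_false.
have lt : last false t by case: Ct => [->|[u -> ?]].
case: Ct' => [->|[u -> lu]].
  by rewrite cats0 /mask_weight /gap_product /= big_ord0 subnn expr0 !mul1r.
rewrite mask_weight_cat // mask_weight_false mask_labels_cons /=.
have -> : (head 0%N [seq i.+1 | i <- mask_labels u]).-1 = head 0%N (mask_labels u).
  by case: mask_labels.
by ring.
Qed.

Lemma head_mask_split t t' : connected_mask t ->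
  head 0%N (mask_labels (false :: t ++ t')) = (head 0%N (mask_labels t)).+1.
Proof.
move=> Ct; have lt : last false t by case: Ct => [->|[u -> ?]].
rewrite mask_labels_cons mask_labels_cat.
have := last_mask_labels lt; case: (mask_labels t) => //.
by case: (t) lt.
Qed.

End MaskLabels.

(** * Invariance under order-preserving relabelling of points *)

Section Transport.
Variables (m M : nat) (h : 'I_m -> 'I_M).
Hypothesis h_mono : forall i j : 'I_m, (h i < h j) = (i < j).
Implicit Types (c d x y : chord m) (S T D : {set chord m}).

Definition map_chord c : chord M := (h c.1, h c.2).

Lemma strict_mono_leq (i j : 'I_m) : (h i <= h j) = (i <= j).
Proof. by rewrite leqNgt h_mono -leqNgt. Qed.

Lemma strict_mono_inj : injective h.
Proof. by move=> i j e; apply/val_inj/eqP; rewrite eqn_leq -!strict_mono_leq e leqnn. Qed.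

Lemma map_chord_inj : injective map_chord.
Proof. by move=> [a b] [c d] [/strict_mono_inj-> /strict_mono_inj->]. Qed.

Lemma crossing_map c d : crossing (map_chord c) (map_chord d) = crossing c d.
Proof. by rewrite /crossing /= !h_mono. Qed.

Lemma ccw_le_map c d : ccw_le (map_chord c) (map_chord d) = ccw_le c d.
Proof. exact: strict_mono_leq. Qed.

Lemma mem_map_chord S c : (map_chord c \in map_chord @: S) = (c \in S).
Proof. exact/mem_imset/map_chord_inj. Qed.

Lemma ccw_inj_map S : ccw_inj S -> ccw_inj (map_chord @: S).
Proof.
move=> iS _ _ /imsetP[x xS ->] /imsetP[y yS ->] /strict_mono_inj xy.
by rewrite (iS _ _ xS yS xy).
Qed.

Lemma ccw_min_map S c : ccw_min S c -> ccw_min (map_chord @: S) (map_chord c).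
Proof.
case/ccw_minP=> cS Hc; apply/ccw_minP; rewrite mem_map_chord; split=> //.
by move=> _ /imsetP[x xS ->]; rewrite ccw_le_map Hc.
Qed.

Lemma connected_map S : connected (map_chord @: S) = connected S.
Proof.
apply/idP/idP => /connectedP coS; apply/connectedP.
  move=> x y xS yS; have := coS (map_chord x) (map_chord y).
  rewrite !mem_map_chord => /(_ xS yS) cxy.
  set a := map_chord @: [set z | connect (crossing_graph S) x z].
  suff cl : closed (crossing_graph (map_chord @: S)) a.
    by have := closed_connect cl cxy; rewrite !mem_map_chord !inE connect0.
  apply: crossing_closed => _ _ /imsetP[z zS ->] /imsetP[w wS ->].
  rewrite crossing_map !mem_map_chord !inE => zw xz.
  by apply: connect_trans xz (connect1 _); rewrite /crossing_graph zS wS.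
move=> _ _ /imsetP[x xS ->] /imsetP[y yS ->].
set a := [pred z | connect (crossing_graph (map_chord @: S)) (map_chord x) (map_chord z)].
suff cl : closed (crossing_graph S) a.
  by have := closed_connect cl (coS x y xS yS); rewrite !inE connect0.
apply: crossing_closed => z w zS wS zw; rewrite !inE => xz.
apply: connect_trans xz (connect1 _).
by rewrite /crossing_graph !mem_map_chord zS wS crossing_map.
Qed.

Lemma map_chordD S T : map_chord @: (S :\: T) = (map_chord @: S) :\: (map_chord @: T).
Proof.
apply/setP => y; apply/imsetP/setDP => [[x + ->]|[/imsetP[x xS ->]]].
  by rewrite !mem_map_chord => /setDP.
by rewrite mem_map_chord => xT; exists x => //; apply/setDP.
Qed.

Lemma component_map S c : c \in S ->
  component (map_chord @: S) (map_chord c) = map_chord @: component S c.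
Proof.
move=> cS; apply: component_eq.
- by rewrite mem_map_chord mem_component.
- exact/imsetS/component_sub.
- by rewrite connected_map component_connected.
move=> _ y /imsetP[x xC ->]; rewrite -map_chordD => /imsetP[z zS ->].
by rewrite crossing_map; apply: component_crossing xC zS.
Qed.

Lemma forest_order_map S : ccw_inj S ->
  forest_order (map_chord @: S) = map map_chord (forest_order S).
Proof.
move: S; apply: forest_ind; first by rewrite imset0 !forest_order0.
move=> S c iS mc IH1 IH2; have /ccw_minP[cS _] := mc.
rewrite (forest_order_unfold iS mc) map_cat /= -IH1 -IH2.
rewrite (forest_order_unfold (ccw_inj_map iS) (ccw_min_map mc)).
by rewrite component_map // !map_chordD imset_set1.
Qed.

Lemma intersection_order_map S : ccw_inj S ->
  intersection_order (map_chord @: S) = map map_chord (intersection_order S).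
Proof.
move=> iS; have [->|S0] := eqVneq S set0; first by rewrite imset0 !intersection_order0.
have [c mc] := ccw_min_exists S0; have /ccw_minP[cS _] := mc.
rewrite (intersection_order_min iS mc) /= -forest_order_map; last first.
  exact: ccw_inj_sub (subsetDl _ _) iS.
by rewrite (intersection_order_min (ccw_inj_map iS) (ccw_min_map mc)) map_chordD imset_set1.
Qed.

Lemma terminal_map S c : terminal (map_chord @: S) (map_chord c) = terminal S c.
Proof.
apply/forall_inP/forall_inP => H d.
  by move=> dS; have := H (map_chord d); rewrite mem_map_chord crossing_map h_mono => ->.
by case/imsetP=> x xS ->; rewrite crossing_map h_mono H.
Qed.

Lemma terminal_mask_map S : ccw_inj S ->
  terminal_mask (map_chord @: S) = terminal_mask S.
Proof.
move=> iS; rewrite /terminal_mask intersection_order_map // -map_comp.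
by apply: eq_map => c /=; rewrite terminal_map.
Qed.

End Transport.

(** * Points of a diagram *)

Section Points.
Variable m : nat.
Implicit Types (c d : chord m) (S T X Y : {set chord m}) (p q x y u v : 'I_m).

Definition covers c p := (p == c.1) || (p == c.2).

Definition points S := [set p | [exists c in S, covers c p]].

(** A diagram without the requirement that every point be used, so that the notion passes to parts
    of a diagram. *)
Definition matching S :=
  {in S, forall c, c.1 < c.2} /\
  {in S &, forall c d p, covers c p -> covers d p -> c = d}.

Lemma pointsP S p : reflect (exists2 c, c \in S & covers c p) (p \in points S).
Proof. by rewrite inE; apply: exists_inP. Qed.

Lemma coversE c p : covers c p = (p == c.1 :> nat) || (p == c.2 :> nat).
Proof. by []. Qed.

Lemma covers1 c : covers c c.1. Proof. by rewrite /covers eqxx. Qed.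
Lemma covers2 c : covers c c.2. Proof. by rewrite /covers eqxx orbT. Qed.

Lemma mem_points1 S c : c \in S -> c.1 \in points S.
Proof. by move=> cS; apply/pointsP; exists c => //; apply: covers1. Qed.

Lemma mem_points2 S c : c \in S -> c.2 \in points S.
Proof. by move=> cS; apply/pointsP; exists c => //; apply: covers2. Qed.

Lemma matching_ccw_inj S : matching S -> ccw_inj S.
Proof.
move=> [_ H] c d cS dS /= e; apply: (H _ _ cS dS c.1); first exact: covers1.
by rewrite e covers1.
Qed.

Lemma matching_sub S T : T \subset S -> matching S -> matching T.
Proof.
move=> /subsetP sTS [H1 H2]; split=> [c /sTS|c d /sTS cS /sTS]; first exact: H1.
exact: H2.
Qed.

Lemma points_sub S T : T \subset S -> points T \subset points S.
Proof.
move=> /subsetP sTS; apply/subsetP => p /pointsP[c /sTS cS cp].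
by apply/pointsP; exists c.
Qed.

Lemma pointsU S T : points (S :|: T) = points S :|: points T.
Proof.
apply/setP => p; apply/idP/idP.
  by case/pointsP => c /setUP[] cS cp; apply/setUP; [left|right]; apply/pointsP; exists c.
by case/setUP; apply/subsetP/points_sub; rewrite ?subsetUl ?subsetUr.
Qed.

Lemma points_disjoint S T :
  matching (S :|: T) -> [disjoint S & T] -> [disjoint points S & points T].
Proof.
move=> [_ H] dST; rewrite -setI_eq0; apply/eqP/setP => p; rewrite !inE.
apply/negP => /andP[/exists_inP[c cS cp] /exists_inP[d dT dp]].
have e : c = d by apply: (H c d) dp; rewrite ?inE ?cS ?dT ?orbT.
by rewrite e in cS; have := disjointFr dST cS; rewrite dT.
Qed.

Lemma matchingU S T :
  matching S -> matching T -> [disjoint points S & points T] -> matching (S :|: T).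
Proof.
move=> [S1 S2] [T1 T2] dST; split=> [c /setUP[/S1|/T1]//|c d].
have contra c1 d1 p : c1 \in S -> d1 \in T -> covers c1 p -> covers d1 p -> c1 = d1.
  move=> cS dT cp dp; have pS : p \in points S by apply/pointsP; exists c1.
  by have := disjointFr dST pS => /pointsP[]; exists d1.
case/setUP=> cS /setUP[] dS p cp dp.
- exact: S2 cp dp.
- exact: contra cp dp.
- by apply/esym/(contra _ _ p).
- exact: T2 cp dp.
Qed.

Lemma card_points S : matching S -> #|points S| = #|S|.*2.
Proof.
move=> [H1 H2].
have -> : points S = [set c.1 | c in S] :|: [set c.2 | c in S].
  apply/setP => p; apply/pointsP/setUP => [[c cS /orP[]/eqP->]|].
  - by left; apply: imset_f.
  - by right; apply: imset_f.
  case=> /imsetP[c cS ->]; exists c => //; [exact: covers1|exact: covers2].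
rewrite cardsU disjoint_setI0; last first.
  rewrite -setI_eq0; apply/eqP/setP => p; rewrite in_setI in_set0.
  apply/negP => /andP[/imsetP[c cS ->] /imsetP[d dS e]].
  have ecd : c = d by apply: (H2 c d cS dS c.1); rewrite ?covers1 // e covers2.
  by have := H1 c cS; rewrite e ecd ltnn.
rewrite cards0 subn0 -addnn !card_in_imset // => c d cS dS /= e.
  by apply: (H2 c d cS dS c.2); rewrite ?covers2 // e covers2.
by apply: (H2 c d cS dS c.1); rewrite ?covers1 // e covers1.
Qed.

(* [(p, q)] need not be a chord of the diagram here: it is any pair of points. *)
Lemma same_side X p q x y :
  connected X -> {in X, forall c, c.1 < c.2} -> p < q ->
  p \notin points X -> q \notin points X ->
  {in X, forall c, ~~ crossing (p, q) c} ->
  x \in points X -> y \in points X -> (p < x < q) = (p < y < q).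
Proof.
move=> coX wX pq pX qX noX.
have ends c z : c \in X -> covers c z -> (p < z < q) = (p < c.1 < q).
  move=> cX; rewrite /covers => /orP[/eqP->//|/eqP->].
  have c12 := wX c cX; have := noX c cX; rewrite /crossing /=.
  have : p != c.1 by apply: contraNneq pX => ->; apply: mem_points1.
  have : p != c.2 by apply: contraNneq pX => ->; apply: mem_points2.
  have : q != c.1 by apply: contraNneq qX => ->; apply: mem_points1.
  have : q != c.2 by apply: contraNneq qX => ->; apply: mem_points2.
  rewrite -!val_eqE /=; lia.
(* Each chord of [X] has both ends between [p] and [q] or neither; crossing chords interlace, so
   they agree on which. *)
have ind b c : c \in X -> (p < c.1 < q) == b -> {in X, forall d, (p < d.1 < q) == b}.
  move=> cX cb; pose a := [pred d : chord m | (p < d.1 < q) == b].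
  apply: (connected_sub_closed (a := a) coX cX cb).
  move=> d e dX eX de; rewrite !inE.
  have := ends d d.2 dX (covers2 d); have := ends e e.2 eX (covers2 e).
  move: de (wX d dX) (wX e eX); rewrite /crossing.
  move: (nat_of_ord d.1) (nat_of_ord d.2) (nat_of_ord e.1) (nat_of_ord e.2).
  by move: (nat_of_ord p) (nat_of_ord q); clear; case: b => *; lia.
case/pointsP=> c cX cx /pointsP[d dX dy]; rewrite (ends c x) // (ends d y) //.
by rewrite (eqP (ind _ c cX (eqxx _) d dX)).
Qed.

(** If a chord of [X] separates [u] from [v], the connected set [Y] would have to cross it;
    otherwise no chord of [X] crosses the pair [(u, v)], and [X] cannot have [x] outside and [y]
    between. *)
Lemma no_interleaving X Y x u y v :
  connected X -> connected Y -> {in X, forall c, c.1 < c.2} ->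
  {in Y, forall c, c.1 < c.2} -> [disjoint points X & points Y] ->
  {in X & Y, forall c d, ~~ crossing c d} ->
  x \in points X -> y \in points X -> u \in points Y -> v \in points Y ->
  x < u -> u < y -> y < v -> False.
Proof.
move=> coX coY wX wY dXY noX xX yX uY vY xu uy yv.
have uv : u < v by apply: ltn_trans yv.
have uX : u \notin points X by rewrite (disjointFl dXY uY).
have vX : v \notin points X by rewrite (disjointFl dXY vY).
have [/exists_inP[d dX cr]|/exists_inPn H] := boolP [exists d in X, crossing (u, v) d].
  have d1 : d.1 \notin points Y by rewrite (disjointFr dXY (mem_points1 dX)).
  have d2 : d.2 \notin points Y by rewrite (disjointFr dXY (mem_points2 dX)).
  have H : {in Y, forall c, ~~ crossing (d.1, d.2) c}.
    by move=> c cY; rewrite -surjective_pairing noX.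
  have := same_side coY wY (wX d dX) d1 d2 H uY vY.
  move: cr (wX d dX); rewrite /crossing /=; lia.
have := same_side coX wX uv uX vX H xX yX; lia.
Qed.

End Points.

Lemma diagramP n (C : {set chord n.*2}) :
  diagram C <-> matching C /\ points C = setT.
Proof.
split.
  case/andP=> /forall_inP H1 /forallP H2; split; last first.
    apply/eqP; rewrite -subTset; apply/subsetP => p _; have /cards1P[c /setP e] := H2 p.
    have /andP[cC cp] : (c \in C) && covers c p by have := e c; rewrite !inE eqxx.
    by apply/pointsP; exists c.
  split=> // c d cC dC p cp dp; have /cards1P[x /setP e] := H2 p.
  have := e c; have := e d; rewrite !inE cC dC /=.
  by rewrite -![_ || _]/(covers _ _) cp dp => /esym/eqP-> /esym/eqP->.
case=> -[H1 H2] H3; apply/andP; split; first exact/forall_inP.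
apply/forallP => p; apply/cards1P; have := in_setT p; rewrite -H3 => /pointsP[c cC cp].
exists c; apply/setP => d; rewrite !inE -![_ || _]/(covers _ _).
apply/andP/eqP => [[dC dp]|->//]; exact: H2 dp cp.
Qed.

Lemma card_diagram n (C : {set chord n.*2}) : diagram C -> #|C| = n.
Proof.
case/diagramP=> mC pC; have := card_points mC; rewrite pC cardsT card_ord.
by move/double_inj.
Qed.

Lemma rccdP n (C : {set chord n.*2}) :
  reflect [/\ 0 < n, matching C, points C = setT & connected C] (C \in rccd n).
Proof.
rewrite inE; apply: (iffP and3P) => -[n0].
  by move=> /diagramP[mC pC] coC.
by move=> mC pC coC; split=> //; apply/diagramP.
Qed.

Section PointsTransport.
Variables (m M : nat) (h : 'I_m -> 'I_M).
Hypothesis h_mono : forall i j : 'I_m, (h i < h j) = (i < j).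
Implicit Types S : {set chord m}.

Lemma covers_map c p : covers (map_chord h c) (h p) = covers c p.
Proof. by rewrite /covers /= !(inj_eq (strict_mono_inj h_mono)). Qed.

Lemma points_map S : points (map_chord h @: S) = h @: points S.
Proof.
apply/setP => p; apply/pointsP/imsetP => [[_ /imsetP[c cS ->]]|[q /pointsP[c cS cq] ->]].
  case/orP=> /eqP->; [exists c.1 | exists c.2] => //; [exact: mem_points1|exact: mem_points2].
by exists (map_chord h c); rewrite ?imset_f // covers_map.
Qed.

Lemma matching_map S : matching (map_chord h @: S) <-> matching S.
Proof.
have inE := mem_map_chord h_mono; split=> -[H1 H2]; split.
- by move=> c cS; rewrite -h_mono; apply: (H1 (map_chord h c)); rewrite inE.
- move=> c d cS dS p cp dp; apply: (map_chord_inj h_mono).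
  by apply: (H2 _ _ _ _ (h p)); rewrite ?inE ?covers_map.
- by move=> _ /imsetP[c cS ->]; rewrite h_mono H1.
move=> _ _ /imsetP[c cS ->] /imsetP[d dS ->] p.
case/orP=> /eqP->; rewrite covers_map => dp; congr map_chord;
  by apply: H2 dp => //; rewrite ?covers1 ?covers2.
Qed.

Lemma map_chord_preimage (S' : {set chord M}) :
  points S' \subset h @: setT -> exists S, S' = map_chord h @: S.
Proof.
move=> /subsetP sS; exists [set c | map_chord h c \in S'].
apply/setP => -[a b]; apply/idP/imsetP => [abS|[c]]; last by rewrite inE => cS ->.
have /imsetP[i _ ei] := sS _ (mem_points1 abS).
have /imsetP[j _ ej] := sS _ (mem_points2 abS).
rewrite /= in ei ej; exists (i, j); first by rewrite inE /map_chord /= -ei -ej.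
by rewrite /map_chord /= ei ej.
Qed.

End PointsTransport.

(** Turns membership in [rccd n] into a condition on the image, where both parts of a glued diagram
    live on the same circle. *)
Lemma rccd_map n M (h : 'I_(n.*2) -> 'I_M)
    (h_mono : forall i j : 'I_(n.*2), (h i < h j) = (i < j)) (C : {set chord n.*2}) :
  C \in rccd n <-> [/\ 0 < n, matching (map_chord h @: C),
                    points (map_chord h @: C) = h @: setT &
                    connected (map_chord h @: C)].
Proof.
rewrite points_map // connected_map //; split=> [/rccdP[n0 mC pC coC]|[n0 mC pC coC]].
  by split; rewrite ?pC //; apply/(matching_map h_mono).
apply/rccdP; split=> //; first exact/(matching_map h_mono).
exact: (imset_inj (strict_mono_inj h_mono)).
Qed.

(** * Root-share decomposition *)

(** [X] is the first component left after deletion of the root chord [c]. The crossing with [e] is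
    recorded because it makes the root chord nonterminal. *)
Definition root_branch m (C X : {set chord m}) :=
  exists c d e, [/\ ccw_min C c, ccw_min (C :\ c) d, X = component (C :\ c) d,
                    e \in X & crossing c e].

Section RootBranch.
Variable m : nat.
Implicit Types C X : {set chord m}.

(** Least chords are unique, so the decomposition can be read back from [C]; injectivity of gluing
    rests on this. *)
Lemma root_branch_uniq C X X' :
  ccw_inj C -> root_branch C X -> root_branch C X' -> X = X'.
Proof.
move=> iC [c [d [_ [mc md -> _ _]]]] [c' [d' [_ [mc' md' -> _ _]]]].
rewrite -(ccw_min_uniq iC mc mc') in md' *.
by rewrite (ccw_min_uniq (ccw_inj_sub (subsetDl C [set c]) iC) md md').
Qed.

Lemma terminal_mask_branch C X : ccw_inj C -> root_branch C X ->
  terminal_mask C = false :: terminal_mask X ++ behead (terminal_mask (C :\: X)).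
Proof.
move=> iC [c [d [e [mc md -> eX ce]]]]; exact: terminal_mask_split mc md eX ce.
Qed.

(** Crossings leave the removed component only through [c], so this component together with the
    chords reachable from [c] outside it is closed under crossing, hence all of [C]. *)
Lemma connected_branch_compl C c d :
  connected C -> c \in C -> d \in C :\ c ->
  connected (C :\: component (C :\ c) d).
Proof.
move=> coC cC dC; set X := component _ _; set Y := C :\: X.
have cX : c \notin X.
  by apply: contraT => /negbNE/(subsetP (component_sub _ _)); rewrite !inE eqxx.
have cY : c \in Y by rewrite in_setD cX.
have H : {in C, forall x, x \in [pred x | (x \in X) || connect (crossing_graph Y) c x]}.
  apply: (connected_sub_closed coC cC); first by rewrite inE connect0 orbT.
  move=> y z yC zC yz.
  change ((y \in X) || connect (crossing_graph Y) c y ->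
          (z \in X) || connect (crossing_graph Y) c z).
  have [//|zX] := boolP (z \in X).
  case: (boolP (y \in X)) => /= [yX _|yX cy].
    have [->|zc] := eqVneq z c; first exact: connect0.
    have zS : z \in (C :\ c) :\: X by rewrite in_setD zX in_setD1 zc.
    by have := component_crossing yX zS; rewrite yz.
  apply: connect_trans cy (connect1 _).
  by rewrite /crossing_graph /Y !in_setD yX zX yC zC.
have G x : x \in Y -> connect (crossing_graph Y) c x.
  by case/setDP=> xC xX; have := H x xC; rewrite inE (negPf xX).
apply/connectedP => x y xY yY.
by apply: connect_trans (G y yY); rewrite crossing_connect_sym G.
Qed.

(** Otherwise the component would be closed under crossing in the connected set [C] without
    containing [c]. *)
Lemma root_component_crossing C c d :
  connected C -> c \in C -> d \in C :\ c ->
  exists2 e, e \in component (C :\ c) d & crossing c e.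
Proof.
move=> coC cC dC; apply/exists_inP; apply: contraT => /exists_inPn H.
have dX := mem_component dC; have dC' : d \in C by case/setD1P: dC.
suff /(_ c cC)/(subsetP (component_sub _ _)) :
    {in C, forall x, x \in component (C :\ c) d} by rewrite !inE eqxx.
apply: (connected_sub_closed coC dC' dX) => y z yC zC yz yX.
apply: contraT => zX; have [zc|zc] := eqVneq z c.
  by have := H y yX; rewrite -zc crossing_sym yz.
have := component_crossing yX; move/(_ z); rewrite in_setD zX in_setD1 zc zC yz.
by move/(_ isT).
Qed.

End RootBranch.

(* The root keeps position 0; the other points of the small diagram are shifted
   by [a], and the points of the inserted component surround them. *)
Definition root_pos a i := if i == 0 then 0 else a + i.
Definition comp_pos k a i := if i < a then i.+1 else i + k.*2.

(** [inord] makes the map total; the bound later assumed on [a] keeps the values in range, so its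
    default never occurs. *)
Definition root_emb n k a (i : 'I_(k.*2)) : 'I_(n.+1.*2) :=
  @inord n.*2.+1 (root_pos a i).
Definition comp_emb n k a (i : 'I_((n.+1 - k).*2)) : 'I_(n.+1.*2) :=
  @inord n.*2.+1 (comp_pos k a i).

(** [a] counts the points of [D] placed before the non-root points of [C1], so
    [0 < a < (n.+1 - k).*2] runs through the inner gaps of [D]. *)
Definition glue n k a (C1 : {set chord k.*2}) (D : {set chord (n.+1 - k).*2}) :
    {set chord n.+1.*2} :=
  map_chord (@root_emb n k a) @: C1 :|: map_chord (@comp_emb n k a) @: D.

(** * Gluing two connected diagrams *)

Section Glue.
Variables n k a : nat.
Hypothesis ok : 0 < a < (n.+1 - k).*2.
Notation rho := (@root_emb n k a).
Notation psi := (@comp_emb n k a).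

Lemma root_embE i : rho i = root_pos a i :> nat.
Proof.
have lt : root_pos a i < n.+1.*2.
  by rewrite /root_pos; have := ltn_ord i; move: ok; case: eqP; lia.
exact: inordK lt.
Qed.

Lemma comp_embE i : psi i = comp_pos k a i :> nat.
Proof.
have lt : comp_pos k a i < n.+1.*2.
  by rewrite /comp_pos; have := ltn_ord i; move: ok; case: (ltnP i a); lia.
exact: inordK lt.
Qed.

Lemma root_emb_mono i j : (rho i < rho j) = (i < j).
Proof.
rewrite !root_embE /root_pos; move: ok.
by case: (eqVneq (i : nat) 0); case: (eqVneq (j : nat) 0); lia.
Qed.

Hypothesis k_gt0 : 0 < k.

Lemma comp_emb_mono i j : (psi i < psi j) = (i < j).
Proof. by rewrite !comp_embE /comp_pos; case: (ltnP i a); case: (ltnP j a); lia. Qed.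

Lemma mem_root_emb p : (p \in rho @: setT) = (p == 0 :> nat) || (a < p < a + k.*2).
Proof.
apply/imsetP/idP => [[i _ ->]|H].
  by rewrite root_embE /root_pos; have := ltn_ord i; case: (eqVneq (i : nat) 0); lia.
have lt : (if p == 0 :> nat then 0 else p - a) < k.*2.
  by move: H; case: (eqVneq (p : nat) 0); lia.
exists (Ordinal lt) => //; apply/val_inj; rewrite /= root_embE /root_pos /=.
by move: H; case: (eqVneq (p : nat) 0) => //= p0 H; rewrite ifN; lia.
Qed.

Lemma mem_comp_emb p : (p \in psi @: setT) = (0 < p <= a) || (a + k.*2 <= p).
Proof.
apply/imsetP/idP => [[i _ ->]|H].
  by rewrite comp_embE /comp_pos; have := ltn_ord i; case: (ltnP i a); lia.
have lt : (if p <= a then p.-1 else p - k.*2) < (n.+1 - k).*2.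
  by have := ltn_ord p; move: ok H; case: (leqP p a); lia.
exists (Ordinal lt) => //; apply/val_inj; rewrite /= comp_embE /comp_pos /=.
by move: H ok; case: (leqP p a) => //; case: ifP; lia.
Qed.

Lemma root_comp_emb : psi @: setT = ~: (rho @: setT).
Proof.
apply/setP => p; rewrite in_setC mem_root_emb mem_comp_emb; have := ltn_ord p; lia.
Qed.

Section GlueRCCD.
Variables (C1 : {set chord k.*2}) (D : {set chord (n.+1 - k).*2}).
Hypotheses (C1_rccd : C1 \in rccd k) (D_rccd : D \in rccd (n.+1 - k)).
Notation Y := (map_chord rho @: C1).
Notation X := (map_chord psi @: D).
Notation C := (glue a C1 D).

Lemma glue_points_disjoint : [disjoint points Y & points X].
Proof.
have [_ _ -> _] := (rccd_map root_emb_mono C1).1 C1_rccd.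
have [_ _ -> _] := (rccd_map comp_emb_mono D).1 D_rccd.
by rewrite root_comp_emb disjoints_subset setCK.
Qed.

Lemma glue_matching : matching C.
Proof.
have [_ mY _ _] := (rccd_map root_emb_mono C1).1 C1_rccd.
have [_ mX _ _] := (rccd_map comp_emb_mono D).1 D_rccd.
exact: matchingU mY mX glue_points_disjoint.
Qed.

Lemma glue_disjoint : [disjoint Y & X].
Proof.
rewrite -setI_eq0; apply/eqP/setP => x; rewrite in_setI in_set0; apply/negP.
case/andP=> /mem_points1 xY /mem_points1 xX.
by have := disjointFr glue_points_disjoint xY; rewrite xX.
Qed.

Lemma glue_setD : C :\: X = Y.
Proof.
by rewrite /glue setDUl setDv setU0; apply/setDidPl; apply: glue_disjoint.
Qed.

(** Point 1 and the last point of the circle belong to [X] and are separated by the root chord, so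
    connectedness of [X] forces a crossing. *)
Lemma glue_root : exists c e d, [/\ c \in Y, c.1 = 0 :> nat, e \in X, crossing c e &
  d \in X /\ d.1 = 1 :> nat].
Proof.
have [_ mY pY _] := (rccd_map root_emb_mono C1).1 C1_rccd.
have [d0 mX pX coX] := (rccd_map comp_emb_mono D).1 D_rccd.
have : (ord0 : 'I_n.*2.+2) \in points Y by rewrite pY mem_root_emb.
case/pointsP=> c cY c0; have c12 := mY.1 c cY.
have {}c0 : c.1 = 0 :> nat.
  by move: c0 c12; rewrite /covers -!val_eqE /=; case: eqP => //= _ /eqP<-.
have lt1 : 1 < n.+1.*2 by [].
have p1X : Ordinal lt1 \in points X by rewrite pX mem_comp_emb /=; move: ok; lia.
have pmX : (ord_max : 'I_n.*2.+2) \in points X.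
  by rewrite pX mem_comp_emb /=; move: ok; lia.
have [e eX ce] : exists2 e, e \in X & crossing c e.
  apply/exists_inP; apply: contraT => /exists_inPn H.
  have nX p : p \in points Y -> p \notin points X.
    by move=> pY'; rewrite (disjointFr glue_points_disjoint pY').
  have H' : {in X, forall e, ~~ crossing (c.1, c.2) e}.
    by move=> e eX; rewrite -surjective_pairing H.
  have := same_side coX mX.1 c12 (nX _ (mem_points1 cY)) (nX _ (mem_points2 cY)) H' p1X pmX.
  have : c.2 \in points Y by apply: mem_points2.
  rewrite pY mem_root_emb /= c0; move: c12 ok (ltn_ord c.2); rewrite c0.
  by move: (nat_of_ord c.2); clear; lia.
have /pointsP[d dX dp] := p1X; exists c, e, d; split=> //; split=> //.
have d12 := mX.1 d dX.
move: dp; rewrite /covers => /orP[/eqP<-//|/eqP d2].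
have : d.1 \in points X by apply: mem_points1.
rewrite pX mem_comp_emb; move: d12; rewrite -d2 /=; move: ok; clear; lia.
Qed.

Lemma glue_rccd : C \in rccd n.+1.
Proof.
have [_ _ pY coY] := (rccd_map root_emb_mono C1).1 C1_rccd.
have [_ _ pX coX] := (rccd_map comp_emb_mono D).1 D_rccd.
apply/rccdP; split=> //; first exact: glue_matching.
  by rewrite pointsU pY pX root_comp_emb setUCr.
have [c [e [d [cY _ eX ce _]]]] := glue_root.
exact: connectedU coY coX cY eX ce.
Qed.

(** The points of [Y] other than the root lie in a window free of points of [X], so only the root
    chord can cross [X]. Moreover [X] owns point 1, hence the second smallest chord. *)
Lemma glue_branch : root_branch C X.
Proof.
have [_ mY pY coY] := (rccd_map root_emb_mono C1).1 C1_rccd.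
have [_ mX pX coX] := (rccd_map comp_emb_mono D).1 D_rccd.
have [_ mC] := glue_matching.
have [c [e [d [cY c0 eX ce [dX d1]]]]] := glue_root.
have cC : c \in C by rewrite in_setU cY.
have dC : d \in C by rewrite in_setU dX orbT.
have cX : c \notin X by rewrite (disjointFr glue_disjoint cY).
have root x : x \in C -> x.1 = 0 :> nat -> x = c.
  move=> xC x0; apply: (mC x c xC cC c.1); last exact: covers1.
  by rewrite /covers -val_eqE /= c0 x0.
have dCc : d \in C :\ c by rewrite in_setD1 dC andbT; apply: contraNneq cX => <-.
have eX' : X = component (C :\ c) d.
  apply/esym/component_eq => //.
    apply/subsetP => x xX; rewrite in_setD1 in_setU xX orbT andbT.
    by apply: contraNneq cX => <-.
  move=> x y xX; rewrite in_setD in_setD1 in_setU => /and3P[yX yc].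
  rewrite (negPf yX) orbF => yY.
  have y0 : y.1 != 0 :> nat.
    by apply: contraNneq yc => y0; apply/eqP/root; rewrite // in_setU yY.
  have := mem_points1 yY; have := mem_points2 yY; rewrite pY !mem_root_emb.
  have := mem_points1 xX; have := mem_points2 xX; rewrite pX !mem_comp_emb.
  have := mX.1 x xX; have := mY.1 y yY; rewrite /crossing.
  move: y0; move: (nat_of_ord x.1) (nat_of_ord x.2) (nat_of_ord y.1) (nat_of_ord y.2).
  move: ok; clear; lia.
exists c, d, e; split=> //.
  by apply/ccw_minP; split=> // x _; rewrite /ccw_le c0.
apply/ccw_minP; split=> // x /setD1P[xc xC]; rewrite /ccw_le d1 lt0n.
by apply: contraNneq xc => x0; apply/eqP/root.
Qed.

End GlueRCCD.
End Glue.

Lemma card_ord_interval N (s z : nat) : z < N -> s <= z ->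
  #|[set p : 'I_N | s <= p <= z]| = z.+1 - s.
Proof.
move=> zN sz; have lt (i : 'I_(z.+1 - s)) : s + i < N by have := ltn_ord i; lia.
pose h i := Ordinal (lt i).
have h_inj : injective h.
  by move=> i j /(congr1 val) /= /addnI/val_inj.
rewrite -[RHS]card_ord -cardsT -(card_imset _ h_inj); apply: eq_card => p.
rewrite inE; apply/idP/imsetP => [H|[i _ ->]] /=; last by have := ltn_ord i; lia.
have lti : p - s < z.+1 - s by lia.
by exists (Ordinal lti) => //; apply/val_inj => /=; lia.
Qed.

(** * Every connected diagram with at least two chords is glued *)

Section RootShare.
Variable n : nat.
Variable C : {set chord n.+1.*2}.
Hypothesis C_rccd : C \in rccd n.+1.
Variables c d : chord n.+1.*2.
Hypotheses (min_c : ccw_min C c) (min_d : ccw_min (C :\ c) d).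
Notation X := (component (C :\ c) d).
Notation Y := (C :\: component (C :\ c) d).

Let matchC : matching C. Proof. by case/rccdP: C_rccd. Qed.
Let coC : connected C. Proof. by case/rccdP: C_rccd. Qed.
Let cC : c \in C. Proof. by case/ccw_minP: min_c. Qed.
Let dS : d \in C :\ c. Proof. by case/ccw_minP: min_d. Qed.
Let sXC : X \subset C.
Proof. by apply: subset_trans (component_sub _ _) _; apply: subsetDl. Qed.
Let YUX : Y :|: X = C.
Proof.
rewrite setUC; apply/setP => x; rewrite !in_setU in_setD.
by have := subsetP sXC x; case: (x \in X) => //= ->.
Qed.

Lemma coversP p : exists2 e, e \in C & covers e p.
Proof. by case/rccdP: C_rccd => _ _ pC _; apply/pointsP; rewrite pC in_setT. Qed.

Lemma covers_uniq e e' p : e \in C -> e' \in C -> covers e p -> covers e' p -> e = e'.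
Proof. by move=> eC e'C; apply: matchC.2. Qed.

Lemma root_fst : c.1 = 0 :> nat.
Proof.
have [e eC] := coversP (ord0 : 'I_n.*2.+2).
have := matchC.1 e eC; have /ccw_minP[_ /(_ e eC)] := min_c; rewrite /ccw_le.
by rewrite coversE /=; clear; lia.
Qed.

(** The root chord crosses every component, so each has points on both sides of it. *)
Lemma component_points e : e \in C :\ c ->
  exists2 u, u \in points (component (C :\ c) e) & exists2 v,
    v \in points (component (C :\ c) e) & 0 < u < c.2 /\ c.2 < v.
Proof.
move=> eS; have [g gE cg] := root_component_crossing coC cC eS.
exists g.1; first exact: mem_points1.
exists g.2; first exact: mem_points2.
by move: cg; rewrite /crossing root_fst ltn0 orbF => /and3P[-> -> ->].
Qed.

Lemma points_branch_compl : points Y = ~: points X.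
Proof.
apply/eqP; rewrite eqEsubset; apply/andP; split.
  rewrite -disjoints_subset; apply: points_disjoint; first by rewrite YUX.
  by rewrite disjoints_subset setDE subsetIr.
apply/subsetP => p; rewrite in_setC => pX; have [e eC ep] := coversP p.
apply/pointsP; exists e => //; rewrite in_setD eC andbT.
by apply: contra pX => eX; apply/pointsP; exists e.
Qed.

Lemma notin_branch e p : e \in Y -> covers e p -> p \notin points X.
Proof.
by move=> eY ep; rewrite -in_setC -points_branch_compl; apply/pointsP; exists e.
Qed.

Lemma root_notin_branch : c \in Y.
Proof.
rewrite in_setD cC andbT; apply/negP => /(subsetP (component_sub _ _)).
by rewrite !inE eqxx.
Qed.

(** A root chord ending at 1 would leave no point between its ends. The chord at 1 then begins no
    earlier than [d], which forces [d] to begin at 1. *)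
Lemma first_point_branch (p : 'I_(n.+1.*2)) : p = 1 :> nat -> p \in points X.
Proof.
move=> p1; have [e eC ep] := coversP p; have dX := mem_component dS.
have [u _ [v _ [uq _]]] := component_points dS.
have ec : e != c.
  apply/eqP => ec; move: ep uq; rewrite ec coversE /= p1 root_fst; clear; lia.
have /ccw_minP[_ /(_ e)] := min_d; rewrite in_setD1 ec eC /ccw_le => /(_ isT) de.
have d0 : d.1 != 0 :> nat.
  apply: contraTneq dS => d0; rewrite in_setD1 negb_and negbK; apply/orP; left.
  apply/eqP/(@covers_uniq _ _ d.1); rewrite ?covers1 //; first by case/setD1P: dS.
  by rewrite coversE /= root_fst d0.
suff -> : p = d.1 by apply: mem_points1.
apply/val_inj; move: ep (matchC.1 e eC) de d0; rewrite coversE /= p1; clear; lia.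
Qed.

(* The root chord crosses every component.  If [r] lay between [u] and [v], the
   component of whichever of [u], [v] is on the same side of the root chord as
   [r] would interleave with [X]. *)
Lemma branch_convex (u r v : 'I_(n.+1.*2)) :
  0 < u -> u < r -> r < v -> u \notin points X -> v \notin points X ->
  r \notin points X.
Proof.
move=> u0 ur rv uX vX; apply/negP => rX.
have one : 1 < n.+1.*2 by [].
have X1 : Ordinal one \in points X by apply: first_point_branch.
(* The component through a point off both [X] and the root chord, with what [no_interleaving] asks
   of it. *)
have other (w : 'I_(n.+1.*2)) : 0 < w -> w != c.2 :> nat -> w \notin points X -> exists2 e,
    e \in C :\ c & [/\ w \in points (component (C :\ c) e), connected (component (C :\ c) e),
      [disjoint points X & points (component (C :\ c) e)] &
      {in X & component (C :\ c) e, forall x y, ~~ crossing x y}].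
  move=> w0 wq wX; have [e eC ew] := coversP w.
  have ec : e != c.
    by apply: contraTneq ew => ->; rewrite coversE root_fst negb_or wq -lt0n w0.
  have eS : e \in C :\ c by rewrite in_setD1 ec eC.
  have eX : e \notin X by apply: contra wX => eX; apply/pointsP; exists e.
  exists e => //; set E := component _ e.
  have sE : E \subset C :\ c :\: X.
    have eSX : e \in C :\ c :\: X by rewrite in_setD eX.
    by rewrite /E -(component_compl eSX); apply: component_sub.
  split.
  - by apply/pointsP; exists e => //; apply: mem_component.
  - exact: component_connected.
  - apply: points_disjoint.
      apply: matching_sub matchC; rewrite subUset sXC.
      by apply: subset_trans (component_sub _ _) _; apply: subsetDl.
    rewrite disjoint_sym disjoints_subset; apply: subset_trans sE _.
    by rewrite setDE subsetIr.
  - by move=> x y xX yE; apply: component_crossing xX (subsetP sE _ yE).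
have w1 (S : {set chord n.+1.*2}) : S \subset C -> {in S, forall x : chord n.+1.*2, x.1 < x.2}.
  by move=> /subsetP sS x /sS; apply: matchC.1.
have wc e : {in component (C :\ c) e, forall x : chord n.+1.*2, x.1 < x.2}.
  by apply: w1; apply: subset_trans (component_sub _ _) _; apply: subsetDl.
have coX := component_connected dS.
have r1 : r != 1 :> nat by move: u0 ur; clear; lia.
have rq : r != c.2 :> nat.
  apply: contraTneq rX => /val_inj->; apply: (notin_branch root_notin_branch).
  exact: covers2.
have u1 : u != 1 :> nat.
  by apply: contraNneq uX => u1; apply: first_point_branch.
have [rltq|qler] := ltnP r c.2.
  have uq : u != c.2 :> nat by move: ur rltq; clear; lia.
  have [e eS [uE coE dXE noXE]] := other u u0 uq uX.
  have [_ _ [w wE [_ qw]]] := component_points eS.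
  apply: (no_interleaving coX coE (wc d) (wc e) dXE noXE X1 rX uE wE) => //=.
    by move: u0 u1; clear; lia.
  exact: ltn_trans qw.
have vq : v != c.2 :> nat by move: rv qler; clear; lia.
have v0 : 0 < v by move: rv; clear; lia.
have [e eS [vE coE dXE noXE]] := other v v0 vq vX.
have [w wE [_ _ [/andP[w0 wq] _]]] := component_points eS.
have wX : w \notin points X by rewrite (disjointFl dXE wE).
have w1' : w != 1 :> nat by apply: contraNneq wX => ?; apply: first_point_branch.
apply: (no_interleaving coX coE (wc d) (wc e) dXE noXE X1 rX wE vE) => //=.
  by move: w0 w1'; clear; lia.
exact: leq_trans qler.
Qed.

(** By convexity the nonzero points outside [X] fill the interval from the least one [s] to the
    greatest one [z]; counting gives its length, and [a] is [s] minus one. *)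
Lemma branch_complement_interval : exists2 a, 0 < a < (n.+1 - #|Y|).*2 &
  forall p, (p \in points Y) = (p == 0 :> nat) || (a < p < a + #|Y|.*2).
Proof.
pose P := [pred p : 'I_(n.+1.*2) | (0 < p) && (p \notin points X)].
have [u _ [g gX [/andP[u_gt0 uq] qg]]] := component_points dS.
have q_gt0 : 0 < c.2 by apply: ltn_trans uq.
have qX : c.2 \notin points X by apply: (notin_branch root_notin_branch); apply: covers2.
have Pq : P c.2 by rewrite /= q_gt0 qX.
have [s /andP[s0 sX] smin] := arg_minnP (fun p : 'I_(n.+1.*2) => nat_of_ord p) Pq.
have [z /andP[z0 zX] zmax] := arg_maxnP (fun p : 'I_(n.+1.*2) => nat_of_ord p) Pq.
have one : 1 < n.+1.*2 by [].
have X1 : Ordinal one \in points X by apply: first_point_branch.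
have s1 : s != 1 :> nat by apply: contraNneq sX => ?; apply: first_point_branch.
have memY p : (p \in points Y) = (p == 0 :> nat) || (s <= p <= z).
  rewrite points_branch_compl in_setC; have [p0|p0] := eqVneq (p : nat) 0.
    by apply: (notin_branch root_notin_branch); rewrite coversE root_fst p0.
  have p_gt0 : 0 < p by rewrite lt0n.
  apply/idP/andP => [pX|[sp pz]].
    have Pp : P p by rewrite /= p_gt0.
    by split; [apply: smin | apply: zmax].
  have [ep|sp'] := eqVneq (s : nat) p; first by rewrite -(val_inj ep).
  have [ep|pz'] := eqVneq (p : nat) z; first by rewrite (val_inj ep).
  by apply: (@branch_convex s p z) => //; rewrite ltn_neqAle ?sp' ?pz'.
have sz : s <= z by apply: leq_trans (smin _ Pq) (zmax _ Pq).
(* The outer successor counts the root point 0. *)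
have cardY : #|Y|.*2 = (z.+1 - s).+1.
  have mY : matching Y by apply: matching_sub matchC; apply: subsetDl.
  rewrite -(card_points mY) -(card_ord_interval (ltn_ord z) sz).
  rewrite (cardsD1 (ord0 : 'I_n.*2.+2) (points Y)) memY /= add1n; congr _.+1.
  apply: eq_card => p; rewrite in_setD1 memY inE -val_eqE /=.
  by have [->|//] := eqVneq (p : nat) 0; rewrite leqNgt s0.
(* If [z] were the last point, convexity between [c.2] and [z] would exclude the point [g] of [X]
   beyond the root chord. This yields the strict upper bound on [a]. *)
have zlt : z < n.*2.+1.
  rewrite ltn_neqAle -ltnS (ltn_ord z) andbT; apply/negP => /eqP ez.
  have gz : g < z.
    rewrite ltn_neqAle ez -ltnS (ltn_ord g) andbT -ez.
    by apply: contraNneq zX => /val_inj<-.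
  by have := @branch_convex c.2 g z q_gt0 qg gz qX zX; rewrite gX.
exists s.-1; first by move: cardY zlt sz s0 s1; clear; lia.
move=> p; rewrite memY; move: cardY s0 sz; clear; lia.
Qed.

Lemma root_share_glue : exists k a C1 D,
  [/\ 0 < a < (n.+1 - k).*2, C1 \in rccd k, D \in rccd (n.+1 - k) &
      C = glue a C1 D].
Proof.
have [a ok memY] := branch_complement_interval; set k := #|Y| in ok memY.
have k_gt0 : 0 < k by apply/card_gt0P; exists c; apply: root_notin_branch.
have eY : points Y = @root_emb n k a @: setT.
  by apply/setP => p; rewrite memY mem_root_emb.
have eX : points X = @comp_emb n k a @: setT.
  by rewrite root_comp_emb // -eY points_branch_compl setCK.
have /map_chord_preimage[C1 e1] : points Y \subset @root_emb n k a @: setT.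
  by rewrite eY.
have /map_chord_preimage[D e2] : points X \subset @comp_emb n k a @: setT.
  by rewrite eX.
exists k, a, C1, D; split=> //.
- apply/(rccd_map (root_emb_mono ok)); rewrite -e1; split=> //.
    by apply: matching_sub matchC; apply: subsetDl.
  exact: connected_branch_compl.
- apply/(rccd_map (comp_emb_mono ok k_gt0)); rewrite -e2; split=> //.
  + by move: ok; clear; lia.
  + exact: matching_sub matchC.
  exact: component_connected.
by rewrite /glue -e1 -e2.
Qed.

End RootShare.

Lemma rccd_glue n (C : {set chord n.+1.*2}) : 0 < n -> C \in rccd n.+1 ->
  exists k a C1 D, [/\ 0 < a < (n.+1 - k).*2, C1 \in rccd k,
                       D \in rccd (n.+1 - k) & C = glue a C1 D].
Proof.
move=> n0 CC; have dC : diagram C by move: CC; rewrite inE => /and3P[].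
have C0 : C != set0 by rewrite -card_gt0 card_diagram.
have [c mc] := ccw_min_exists C0; have /ccw_minP[cC _] := mc.
have S0 : C :\ c != set0.
  by move: (card_diagram dC); rewrite (cardsD1 c) cC add1n -card_gt0 => -[->].
have [d md] := ccw_min_exists S0.
exact (root_share_glue CC mc md).
Qed.

(** The diagram determines its branch, hence the complement; the size of the latter gives [k] and
    its points give [a]. The small diagrams can be compared only once their types agree. *)
Lemma glue_inj n k k' a a' (C1 : {set chord k.*2}) (C1' : {set chord k'.*2}) D D' :
  0 < a < (n.+1 - k).*2 -> 0 < a' < (n.+1 - k').*2 ->
  C1 \in rccd k -> C1' \in rccd k' -> D \in rccd (n.+1 - k) -> D' \in rccd (n.+1 - k') ->
  glue a C1 D = glue a' C1' D' -> k = k' /\ a = a'.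
Proof.
move=> ok ok' C1k C1k' Dk Dk' e.
have k0 : 0 < k by case/rccdP: C1k.
have k0' : 0 < k' by case/rccdP: C1k'.
have := root_branch_uniq (matching_ccw_inj (glue_matching ok k0 C1k Dk))
  (glue_branch ok k0 C1k Dk); rewrite e.
move=> /(_ _ (glue_branch ok' k0' C1k' Dk')) eX.
have eY := glue_setD ok k0 C1k Dk; rewrite eX e (glue_setD ok' k0' C1k' Dk') in eY.
have cardC1 l (E : {set chord l.*2}) : E \in rccd l -> #|E| = l.
  by rewrite inE => /and3P[_ dE _]; apply: card_diagram.
have ek : k = k'.
  rewrite -(cardC1 _ _ C1k) -(cardC1 _ _ C1k').
  have := congr1 (fun S : {set chord n.+1.*2} => #|S|) eY.
  by rewrite !card_imset //; apply: map_chord_inj; apply: root_emb_mono.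
split=> //; subst k'.
have [_ _ pY _] := (rccd_map (root_emb_mono ok) C1).1 C1k.
have [_ _ pY' _] := (rccd_map (root_emb_mono ok') C1').1 C1k'.
have memY p : (p \in @root_emb n k a @: setT) = (p \in @root_emb n k a' @: setT).
  by rewrite -pY -pY' eY.
(* [a.+1] and [a'.+1] are the least nonzero points of the two windows, so testing these two
   suffices. *)
have lt : a.+1 < n.+1.*2 by move: ok k0; clear; lia.
have lt' : a'.+1 < n.+1.*2 by move: ok' k0; clear; lia.
have := memY (Ordinal lt); have := memY (Ordinal lt').
by rewrite !mem_root_emb //=; move: k0; clear; lia.
Qed.

(** * The recurrence for weighted sums *)

Local Open Scope ring_scope.

Lemma rccd_connected_mask n (C : {set chord n.*2}) :
  C \in rccd n -> connected_mask (terminal_mask C).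
Proof.
move=> CC; have [n0 mC _ coC] := rccdP _ CC.
apply: terminal_mask_connected => //; first exact: matching_ccw_inj.
by rewrite -card_gt0 card_diagram //; move: CC; rewrite inE => /and3P[].
Qed.

Lemma rccd_ccw_inj n (C : {set chord n.*2}) : C \in rccd n -> ccw_inj C.
Proof. by case/rccdP => _ /matching_ccw_inj. Qed.

Lemma first_terminal_mask m (C : {set chord m}) : ccw_inj C ->
  first_terminal C = head 0%N (mask_labels (terminal_mask C)).
Proof. by move=> iC; rewrite /first_terminal terminal_labels_mask. Qed.

Lemma first_terminal_gt0 n (C : {set chord n.*2}) :
  C \in rccd n -> (0 < first_terminal C)%N.
Proof.
move=> CC; rewrite (first_terminal_mask (rccd_ccw_inj CC)).
case: (rccd_connected_mask CC) => [->//|[t -> lt]].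
rewrite mask_labels_cons /=; have := last_mask_labels lt.
by case: (mask_labels t) => //; case: t lt.
Qed.

Lemma rccd0 : rccd 0 = set0.
Proof. by apply/setP => C; rewrite !inE. Qed.

Lemma rccd1 : rccd 1 = [set [set ((ord0, ord_max) : chord 1.*2)]].
Proof.
apply/setP => C; rewrite in_set1; apply/idP/eqP => [CC|->].
  have := CC; rewrite inE => /and3P[_ dC _].
  have [c eC] := cards1P (introT eqP (card_diagram dC)).
  have [_ [wC _] _ _] := rccdP _ CC.
  have : (c.1 < c.2)%N by apply: wC; rewrite eC set11.
  have := ltn_ord c.2; rewrite eC => lt2 lt12; congr [set _].
  rewrite [LHS]surjective_pairing; congr (_, _); apply/val_inj => /=;
    by move: lt2 lt12; move: (nat_of_ord c.1) (nat_of_ord c.2); clear => /=; lia.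
apply/rccdP; split=> //.
- split=> [c /set1P->//|c d /set1P-> /set1P-> //].
- apply/eqP; rewrite -subTset; apply/subsetP => p _; apply/pointsP.
  exists (ord0, ord_max); first exact: set11.
  by rewrite coversE /=; have := ltn_ord p; move: (nat_of_ord p); clear => /=; lia.
by apply/connectedP => c d /set1P-> /set1P->; apply: connect0.
Qed.

Section RootShareSum.
Variables (K : fieldType) (f : nat -> K).
Implicit Types g : nat -> K.

(** [g] is left free so that one recurrence serves both kinds of sums in the theorem, with an
    indicator or with [f] at a shifted argument. *)
Definition rccd_sum g n : K := \sum_(C in rccd n) weight f C * g (first_terminal C).

Lemma eq_rccd_sum g g' n : (forall b, (0 < b)%N -> g b = g' b) ->
  rccd_sum g n = rccd_sum g' n.
Proof. by move=> e; apply: eq_bigr => C CC; rewrite e // (first_terminal_gt0 CC). Qed.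

Lemma rccd_sum0 g : rccd_sum g 0 = 0.
Proof. by rewrite /rccd_sum rccd0 big_set0. Qed.

Lemma rccd_sum1 g : rccd_sum g 1 = g 1%N.
Proof.
rewrite /rccd_sum rccd1 big_set1; set C := [set _].
have CC : C \in rccd 1 by rewrite rccd1 set11.
have iC := rccd_ccw_inj CC.
have tC : terminal_mask C = [:: true].
  have := size_terminal_mask iC; rewrite cards1.
  by case: (rccd_connected_mask CC) => [//|[t -> +]]; case: t.
rewrite (weight_mask f iC) (first_terminal_mask iC) tC.
by rewrite /mask_weight /gap_product /= big_ord0 subnn expr0 !mul1r.
Qed.

Lemma weight_glue n k a (C1 : {set chord k.*2}) (D : {set chord (n.+1 - k).*2}) :
  (0 < a < (n.+1 - k).*2)%N -> C1 \in rccd k -> D \in rccd (n.+1 - k) ->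
  weight f (glue a C1 D) = weight f C1 * f (first_terminal C1).-1 * weight f D /\
  first_terminal (glue a C1 D) = (first_terminal D).+1.
Proof.
move=> ok C1k Dk; have k0 : (0 < k)%N by case/rccdP: C1k.
have iC := matching_ccw_inj (glue_matching ok k0 C1k Dk).
have := terminal_mask_branch iC (glue_branch ok k0 C1k Dk).
rewrite (glue_setD ok k0 C1k Dk) !terminal_mask_map; try exact: rccd_ccw_inj;
  [|exact: root_emb_mono|exact: comp_emb_mono] => tC.
rewrite !weight_mask ?first_terminal_mask ?tC; try exact: rccd_ccw_inj; try done.
split; first by rewrite mask_weight_split //; apply: rccd_connected_mask.
by rewrite head_mask_split //; apply: rccd_connected_mask.
Qed.

(** Sorting glued diagrams by the size [k] of the part holding the root and by the gap [a] gives the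
    convolution; the odd factor counts the gaps. The terms [k = 0] and [k = n.+1] vanish since
    [rccd 0] is empty. *)
Lemma rccd_sumS g n : (0 < n)%N ->
  rccd_sum g n.+1 = \sum_(k < n.+2) rccd_sum (fun b => f b.-1) k *
    (((n.+1 - k).*2.-1)%:R * rccd_sum (fun b => g b.+1) (n.+1 - k)).
Proof.
move=> n0.
pose ok (ka : 'I_n.+2 * 'I_(n.+1.*2)) := (0 < ka.2 < (n.+1 - ka.1).*2)%N.
(* The gap ranges over a type independent of [k]; inadmissible pairs get the empty class. *)
pose F (ka : 'I_n.+2 * 'I_(n.+1.*2)) : {set {set chord n.+1.*2}} :=
  if ok ka then [set @glue n ka.1 ka.2 p.1 p.2 | p in setX (rccd ka.1) (rccd (n.+1 - ka.1))]
  else set0.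
have memF ka C : C \in F ka -> exists C1 D, [/\ ok ka, C1 \in rccd ka.1,
    D \in rccd (n.+1 - ka.1) & C = glue ka.2 C1 D].
  rewrite /F; case: ifP => [oka|_]; last by rewrite inE.
  by case/imsetP=> -[C1 D] /setXP[C1k Dk] ->; exists C1, D.
have eF : rccd n.+1 = \bigcup_ka F ka.
  apply/setP => C; apply/idP/bigcupP => [CC|[ka _ /memF[C1 [D [oka C1k Dk ->]]]]].
    have [k [a [C1 [D [oka C1k Dk eC]]]]] := rccd_glue n0 CC.
    have ltk : (k < n.+2)%N by move: oka; clear; lia.
    have lta : (a < n.+1.*2)%N by move: oka; clear; lia.
    exists (Ordinal ltk, Ordinal lta) => //; rewrite /F /ok /= oka.
    by apply/imsetP; exists (C1, D) => //; apply/setXP.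
  by apply: glue_rccd => //; case/rccdP: C1k.
rewrite {1}/rccd_sum eF partition_disjoint_bigcup; last first.
  move=> x y; apply: contraNT; rewrite -setI_eq0 => /set0Pn[C /setIP[]].
  move=> /memF[C1 [D [okx C1k Dk ->]]] /memF[C1' [D' [oky C1k' Dk' e]]].
  have [e1 e2] := glue_inj okx oky C1k C1k' Dk Dk' e.
  by apply/eqP/injective_projections; apply: val_inj.
have sumF ka : \sum_(C in F ka) weight f C * g (first_terminal C) =
    if ok ka then rccd_sum (fun b => f b.-1) ka.1 *
      rccd_sum (fun b => g b.+1) (n.+1 - ka.1) else 0.
  rewrite /F; case: ifP => oka; last by rewrite big_set0.
  (* For fixed [k] and [a] both parts are recovered from the glued set: one as its branch, the other
     as the complement. *)
  rewrite big_imset /=; last first.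
    move=> [C1 D] [C1' D'] /setXP[C1k Dk] /setXP[C1k' Dk'] /= e.
    have k0 : (0 < ka.1)%N by case/rccdP: C1k.
    have eX := root_branch_uniq (matching_ccw_inj (glue_matching oka k0 C1k Dk))
      (glue_branch oka k0 C1k Dk).
    rewrite e in eX; have {}eX := eX _ (glue_branch oka k0 C1k' Dk').
    have eY := glue_setD oka k0 C1k Dk; rewrite e eX (glue_setD oka k0 C1k' Dk') in eY.
    congr (_, _).
      exact/esym/(imset_inj (map_chord_inj (root_emb_mono oka))).
    exact: (imset_inj (map_chord_inj (comp_emb_mono oka k0))) eX.
  rewrite (eq_bigl (fun p => (p.1 \in rccd ka.1) && (p.2 \in rccd (n.+1 - ka.1)))); last first.
    by move=> [C1 D]; rewrite in_setX.
  rewrite /rccd_sum big_distrl /=.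
  under [RHS]eq_bigr do rewrite big_distrr /=.
  rewrite pair_big /=; apply: eq_bigr => -[C1 D] /= /andP[C1k Dk].
  by have [-> ->] := weight_glue oka C1k Dk; ring.
rewrite (eq_bigr _ (fun ka _ => sumF ka)) -(pair_bigA _ (fun k a =>
  if ok (k, a) then rccd_sum (fun b => f b.-1) k *
    rccd_sum (fun b => g b.+1) (n.+1 - k) else 0)) /=.
apply: eq_bigr => k _; rewrite -big_mkcond /= sumr_const mulrCA mulr_natl.
congr (_ *+ _); rewrite /ok /=.
have [->|] := eqVneq (n.+1 - k)%N 0%N.
  by apply: eq_card0 => a; rewrite !inE; lia.
move=> nk; have lt : ((n.+1 - k).*2.-1 < n.+1.*2)%N by lia.
have le : (1 <= (n.+1 - k).*2.-1)%N by lia.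
have := card_ord_interval lt le; rewrite subn1 /= cardsE => <-.
by apply: eq_card => a; rewrite !unfold_in; move: (nat_of_ord a) nk; clear; lia.
Qed.

End RootShareSum.

(** * Generating series *)

(** Pascal's rule. With iterates of an operator for [a] and [b], it applies the operator once more
    to either factor. *)
Lemma binomial_convolutionS (R : pzRingType) (a b : nat -> R) j :
  \sum_(l < j.+2) (a l * b (j.+1 - l)%N) *+ 'C(j.+1, l) =
  \sum_(l < j.+1) (a l.+1 * b (j - l)%N + a l * b (j - l).+1) *+ 'C(j, l).
Proof.
rewrite big_ord_recl /= bin0.
under eq_bigr => l _ do rewrite /bump /= add1n binS mulrnDr subSS.
under [RHS]eq_bigr => l _ do rewrite mulrnDl.
rewrite !big_split /= addrA [RHS]addrC; congr (_ + _).
rewrite big_ord_recr /= bin_small // mulr0n addr0 [RHS]big_ord_recl /= subn0 bin0.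
rewrite subn0; congr (_ + _); apply: eq_bigr => l _.
by rewrite /bump /= add1n subnSK.
Qed.

Section RenormalizationGroup.
Variables (K : fieldType) (P : {poly K}).
Implicit Types p q G B : {poly K}.

(** The operator [L = A_1 (2 X d/dX - 1)], with a polynomial [P] for the series [A_1]. *)
Definition rg_op p := P * (('X * p^`()) *+ 2 - p).

Lemma coef_rg_op p n :
  (rg_op p)`_n = \sum_(k < n.+1) P`_k * (p`_(n - k) *+ (n - k).*2 - p`_(n - k)).
Proof.
rewrite /rg_op coefM; apply: eq_bigr => k _; congr (_ * _).
rewrite coefB coefMn coefXM coef_deriv; case: (n - k)%N => [|m] /=.
  by rewrite mul0rn mulr0n.
by rewrite -mulrnA muln2.
Qed.

Definition leibniz_sum G B j :=
  \sum_(l < j.+1) (iter l rg_op G * iter (j - l) rg_op B) *+ 'C(j, l).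

(* [2 X d/dX - 1] is not a derivation, but acting on both factors of a product
   it adds up to [2 X d/dX - 2]. *)
Lemma leibniz_sumS G B j :
  leibniz_sum G B j.+1 =
  P * (('X * (leibniz_sum G B j)^`()) *+ 2 - leibniz_sum G B j *+ 2).
Proof.
rewrite /leibniz_sum.
rewrite (binomial_convolutionS (fun l => iter l rg_op G) (fun l => iter l rg_op B)).
rewrite raddf_sum /= mulr_sumr -!sumrMnl -sumrB mulr_sumr.
apply: eq_bigr => l _; rewrite derivMn derivM /rg_op.
move: (iter l _ G) (iter (j - l) _ B) => p q; rewrite !mulrnDl; ring.
Qed.

(** Only the first step needs computing: [2 X d/dX - 2] kills ['X], and afterwards the recursion
    propagates 0. *)
Lemma leibniz_sum_vanish j : (0 < j)%N -> leibniz_sum 1 'X j = 0.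
Proof.
elim: j => // j IH _; rewrite leibniz_sumS; case: j IH => [_|j ->//].
  rewrite /leibniz_sum big_ord_recl big_ord0 /= mul1r bin0 addr0 derivX mulr1.
  by rewrite subrr mulr0.
by rewrite derivC mulr0 !mul0rn subr0 mulr0.
Qed.

End RenormalizationGroup.

(** * Coefficients of the iterates as weighted sums *)

Section Coefficients.
Variables (K : fieldType) (f : nat -> K) (N : nat).
Implicit Types g : nat -> K.

(** [A_1] truncated after degree [N], which does not affect coefficients of the iterates up to that
    degree. *)
Definition gamma_poly : {poly K} := \poly_(k < N.+1) rccd_sum f (fun b => f b.-1) k.

(** [rccd_sumS] starts at degree 2. In degree 1 the operator yields 0, whence the condition on
    [g 1]; the scalar [c] lets a sign pass through. *)
Lemma coef_rg_op_rccd g (c : K) (p : {poly K}) : g 1%N = 0 ->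
  (forall n, (n <= N)%N -> p`_n = c * rccd_sum f (fun b => g b.+1) n) ->
  forall n, (n <= N)%N -> (rg_op gamma_poly p)`_n = c * rccd_sum f g n.
Proof.
move=> g1 Hp n nN; rewrite coef_rg_op.
have -> : \sum_(k < n.+1) gamma_poly`_k * (p`_(n - k) *+ (n - k).*2 - p`_(n - k)) =
  c * \sum_(k < n.+1) rccd_sum f (fun b => f b.-1) k *
    (((n - k).*2.-1)%:R * rccd_sum f (fun b => g b.+1) (n - k)).
  rewrite mulr_sumr; apply: eq_bigr => k _.
  have kn : (k < n.+1)%N by [].
  rewrite coef_poly ltnS (leq_trans _ nN) // Hp; last by apply: leq_trans nN; apply: leq_subr.
  (* At [n - k = 0] the truncated predecessor gives 0 instead of -1, harmlessly, because sums over
     [rccd 0] vanish. *)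
  case: (n - k)%N => [|m]; first by rewrite !rccd_sum0; ring.
  by rewrite doubleS /= -mulr_natr -natr1; ring.
case: n nN => [|[|n]] nN.
- by rewrite big_ord1 !rccd_sum0 mul0r.
- by rewrite big_ord_recl big_ord1 /= !rccd_sum0 rccd_sum1 g1; ring.
by rewrite -rccd_sumS.
Qed.

(** With value 0 below [l], raising [l] and [b] together changes nothing, so each application of the
    operator raises [l] by one. *)
Definition tail_gap l b : K := if (l <= b)%N then f (b - l)%N else 0.

(** The sign comes from the first step, where the derivative of 1 vanishes and [L 1 = - P]; further
    steps only raise the index. *)
Lemma coef_iter_rg1 l n : (n <= N)%N ->
  (iter l.+1 (rg_op gamma_poly) 1)`_n = - rccd_sum f (tail_gap l.+1) n.
Proof.
elim: l n => [|l IH] n nN.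
  rewrite /= /rg_op -[1]/(1%:P) derivC mulr0 mul0rn sub0r mulrN.
  rewrite mulr1 coefN coef_poly ltnS nN.
  by congr (- _); apply: eq_rccd_sum => b b0; rewrite /tail_gap b0 subn1.
rewrite iterS -mulN1r; apply: coef_rg_op_rccd nN => // m mN.
by rewrite IH // mulN1r.
Qed.

Lemma coef_iter_rgX j n : (n <= N)%N ->
  (iter j (rg_op gamma_poly) 'X)`_n = rccd_sum f (fun b => (b == j.+1)%:R) n.
Proof.
elim: j n => [|j IH] n nN.
  rewrite /= coefX; case: n nN => [|[|n]] nN; rewrite ?rccd_sum0 ?rccd_sum1 //=.
  (* In size at least 2 the first terminal label is that of the branch plus one, hence never 1. *)
  rewrite rccd_sumS // big1 // => k _.
  rewrite (_ : rccd_sum f (fun b => (b.+1 == 1)%:R) _ = 0) ?mulr0 //.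
  by apply: big1 => C CC; rewrite eqSS -leqn0 leqNgt (first_terminal_gt0 CC) mulr0.
rewrite iterS -[RHS]mul1r; apply: coef_rg_op_rccd nN => // m mN.
by rewrite IH // mul1r.
Qed.

End Coefficients.

Theorem proposition4p3 (K : fieldType) (charK0 : [pchar K] =i pred0)
    (f : nat -> K) (i j : nat) (hi : (1 <= i)%N) (hj : (1 <= j)%N) :
  \sum_(C in rccd i.+1 | first_terminal C == j.+1) weight f C =
  \sum_(1 <= k < i.+1) \sum_(1 <= l < j.+1)
    'C(j, l)%:R *
    (\sum_(C in rccd k | (l <= first_terminal C)%N) weight f C * f (first_terminal C - l)%N) *
    (\sum_(C in rccd (i - k + 1) | first_terminal C == (j - l + 1)%N) weight f C).
Proof.
have sumB n b : \sum_(C in rccd n | first_terminal C == b) weight f C =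
    rccd_sum f (fun t => (t == b)%:R) n.
  rewrite big_mkcondr; apply: eq_bigr => C _.
  by case: eqP => _; rewrite ?mulr1 ?mulr0.
have sumA n l : \sum_(C in rccd n | (l <= first_terminal C)%N)
    weight f C * f (first_terminal C - l)%N = rccd_sum f (tail_gap f l) n.
  rewrite big_mkcondr; apply: eq_bigr => C _; rewrite /tail_gap.
  by case: ifP => _; rewrite ?mulr0.
(* In degree [i.+1] of the vanishing sum, the term [l = 0] is the left side; the others carry a
   minus sign and give the right side. *)
have := congr1 (fun p : {poly K} => p`_(i.+1)) (leibniz_sum_vanish (gamma_poly f i.+1) hj).
rewrite coef0 coef_sum big_ord_recl /= subn0 bin0 mul1r coef_iter_rgX // => /eqP.
rewrite addr_eq0 => /eqP; rewrite sumB => ->.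
rewrite exchange_big_nat /= big_add1 /= big_mkord -sumrN.
apply: eq_bigr => l _; rewrite /bump /= add1n coefMn coefM -mulNrn -sumrN.
(* The two end terms of each Cauchy product vanish because there are no diagrams of size 0, which
   leaves the sizes from 1 to [i]. *)
rewrite big_ord_recl big_ord_recr /= subn0 subnn.
rewrite (coef_iter_rg1 f (N := i.+1)) // rccd_sum0 oppr0 mul0r oppr0 add0r.
rewrite (coef_iter_rgX f (N := i.+1)) // rccd_sum0 mulr0 oppr0 addr0.
rewrite -[LHS]mulr_natl big_add1 /= big_mkord mulr_sumr; apply: eq_bigr => k _.
have ki := ltn_ord k; rewrite /bump /= add1n subSS sumA sumB !addn1 (@subnSK k i) //.
have kN : (k.+1 <= i.+1)%N by lia.
have kN' : (i - k <= i.+1)%N by lia.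
have := coef_iter_rg1 f l kN; have := coef_iter_rgX f (j - l.+1) kN'.
by rewrite /= => -> ->; ring.
Qed.
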